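(* There is an absolute constant $C_1>0$ such that, writing $C_{1,\beta}=2^{-1/2}C_1(\beta^{-1}+1)$ for $\beta>0$, the following holds for $d=1$. Let $\alpha,\beta>0$ and $0<R_e\le \dfrac{\alpha^{1/8}}{2^{7/2}C_{1,\beta}^{1/4}}$. (a) Let $f_0\in\mathcal{M}_{\alpha,\beta}$ with $\|f_0\|_{\alpha,\beta}\le R_e$. Then the 6-wave kinetic equation has a unique mild solution $f$ with initial data $f_0$ satisfying the bound $|||T^{-t}f(t)|||_{\alpha,\beta}\le 2R_e$. (b) If $f_0,g_0\in\mathcal{M}_{\alpha,\beta}$ with $\|f_0\|_{\alpha,\beta},\|g_0\|_{\alpha,\beta}\le R_e$, and $f$ and $g$ are the corresponding mild solutions satisfying $|||T^{-t}f(t)|||_{\alpha,\beta}\le 2R_e$ and $|||T^{-t}g(t)|||_{\alpha,\beta}\le 2R_e$, then $$|||T^{-t}f(t)-T^{-t}g(t)|||_{\alpha,\beta}\le 2\|f_0-g_0\|_{\alpha,\beta}.$$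
   Context: Here $d=1$, $t\in\mathbb{R}$, $x,v\in\mathbb{R}^d$. ''Measurable'' means Borel measurable; functions of $(t,x,v)$ are jointly measurable. Spaces. $\mathcal{M}_{\alpha,\beta}$ is the space of measurable $g:\mathbb{R}^d\times\mathbb{R}^d\to\mathbb{R}$ with $\|g\|_{\alpha,\beta}:=\sup_{x,v}|g(x,v)|e^{\alpha|x|^2+\beta|v|^2}<\infty$. $L^\infty(\mathbb{R},\mathcal{M}_{\alpha,\beta})$ is the space of time-dependent functions $g(t,x,v)$ with $|||g|||_{\alpha,\beta}:=\sup_{t\in\mathbb{R}}\|g(t)\|_{\alpha,\beta}<\infty$. Transport. $(T^sg)(t,x,v):=g(t,x-sv,v)$. So $T^{-t}f(t)$ is the function $(x,v)\mapsto f(t,x+tv,v)$, and $T^{-s}\mathcal{C}_6[f](s,x,v)=\mathcal{C}_6[f](s,x+sv,v)$. The notation $|||T^{-t}f(t)|||_{\alpha,\beta}$ means $\sup_{t\in\mathbb{R}}\|T^{-t}f(t)\|_{\alpha,\beta}$. Equation. The 6-wave kinetic equation with initial data $f_0$ is $\partial_tf+v\cdot\nabla_xf=\mathcal{C}_6[f]$, $f(t=0)=f_0$, where $$\mathcal{C}_6[f](t,x,v)=\int_{\mathbb{R}^{5d}}\delta(\Sigma)\delta(\Omega)\Big[f_3f_4f_5(ff_1+ff_2+f_1f_2)-ff_1f_2(f_3f_4+f_3f_5+f_4f_5)\Big]dv_1\cdots dv_5,$$ $f=f(t,x,v)$, $f_i=f(t,x,v_i)$, $\Sigma=v+v_1+v_2-v_3-v_4-v_5$,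 $\Omega=|v|^2+|v_1|^2+|v_2|^2-|v_3|^2-|v_4|^2-|v_5|^2$. Meaning of the deltas: $\delta(\Sigma)$ sets $v_5=v+v_1+v_2-v_3-v_4$; then, for fixed $v,v_1,v_2$, with $h(v_3,v_4)$ denoting $\Omega$ after this substitution, $\int_{\mathbb{R}^{2d}}\delta(h)F\,dv_3dv_4:=\int_{\{h=0\}}\frac{F}{|\nabla h|}\,d\mathcal{H}^{2d-1}$ (surface measure on the zero set of $h$ in $\mathbb{R}^{2d}$). Mild solution. For $f_0\in\mathcal{M}_{\alpha,\beta}$, a measurable $f:\mathbb{R}\times\mathbb{R}^d\times\mathbb{R}^d\to\mathbb{R}$ is a mild solution with initial data $f_0$ if $T^{-t}f(t)\in L^\infty(\mathbb{R},\mathcal{M}_{\alpha,\beta})$ and $T^{-t}f(t,x,v)=f_0(x,v)+\int_0^tT^{-s}\mathcal{C}_6[f](s,x,v)\,ds$ for all $t\in\mathbb{R}$. *)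

(* Defs.v *)
From mathcomp Require Import all_boot all_order all_algebra.
From mathcomp Require Import all_classical all_reals all_analysis.
Set Implicit Arguments.
Unset Strict Implicit.
Unset Printing Implicit Defensive.
Import Order.TTheory GRing.Theory Num.Theory.
Import numFieldNormedType.Exports.

Local Open Scope classical_set_scope.
Local Open Scope ring_scope.

Section hausdorff.
Context {R : realType}.

(* The metric-space structure of the library on R * R is the one of the max
   norm; the Hausdorff measure below is the one of the Euclidean distance. *)
Definition euclid_dist (p q : R * R) : R :=
  Num.sqrt ((p.1 - q.1) ^+ 2 + (p.2 - q.2) ^+ 2).

(* 0 is added to the set of distances so that the empty set has diameter 0
   rather than -oo *)
Definition euclid_diam (A : set (R * R)) : \bar R :=
  ereal_sup ([set 0%E] `|`
             [set (euclid_dist p.1 p.2)%:E | p in [set p | A p.1 /\ A p.2]]).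

Definition hausdorff1_delta (delta : R) (A : set (R * R)) : \bar R :=
  ereal_inf [set (\sum_(0 <= k <oo) euclid_diam (U k))%E
            | U in [set U : nat -> set (R * R) |
                A `<=` \bigcup_k U k /\
                forall k, (euclid_diam (U k) <= delta%:E)%E]].

(* H^1 on R^2. In dimension 1 the usual normalising factor is 1. This is an
   outer measure, defined on all sets; integrals against it only use its values
   on Borel sets, on which it is a measure. *)
Definition hausdorff1 (A : set (R * R)) : \bar R :=
  ereal_sup [set hausdorff1_delta delta A | delta in [set delta | 0 < delta]].

Definition grad_norm (h : R * R -> R) (p : R * R) : R :=
  Num.sqrt (derive1 (fun a : R => h (a, p.2)) p.1 ^+ 2
          + derive1 (fun b : R => h (p.1, b)) p.2 ^+ 2).

Definition delta_integral (h F : R * R -> R) : \bar R :=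
  (\int[hausdorff1]_(q in [set q | h q = 0%R]) (F q / grad_norm h q)%R%:E)%E.

End hausdorff.

Section wave_kinetic.
Context {R : realType}.

Definition norm_ab (alpha beta : R) (g : R -> R -> R) : \bar R :=
  ereal_sup (range (fun p : R * R =>
    (`|g p.1 p.2| * expR (alpha * `|p.1| ^+ 2 + beta * `|p.2| ^+ 2))%:E)).

Definition M_space (alpha beta : R) (g : R -> R -> R) : Prop :=
  measurable_fun setT (fun p : R * R => g p.1 p.2) /\
  (norm_ab alpha beta g < +oo)%E.

Definition tnorm_ab (alpha beta : R) (g : R -> R -> R -> R) : \bar R :=
  ereal_sup (range (fun t : R => norm_ab alpha beta (g t))).

Definition jointly_measurable (g : R -> R -> R -> R) : Prop :=
  measurable_fun setT (fun p : R * R * R => g p.1.1 p.1.2 p.2).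

Definition Linfty_M (alpha beta : R) (g : R -> R -> R -> R) : Prop :=
  jointly_measurable g /\ (tnorm_ab alpha beta g < +oo)%E.

Definition transport (Y : Type) (s : R) (g : R -> R -> R -> Y) :
  R -> R -> R -> Y := fun t x v => g t (x - s * v) v.

(* the function (t, x, v) |-> (T^{-t} f(t))(x, v) = f(t, x + t v, v) *)
Definition along_flow (Y : Type) (f : R -> R -> R -> Y) : R -> R -> R -> Y :=
  fun t => transport (- t) f t.

(* v5 as determined by delta(Sigma), for w = (v1, v2) and q = (v3, v4) *)
Definition v5_of (v : R) (w q : R * R) : R := v + w.1 + w.2 - q.1 - q.2.

(* Omega after the substitution of v5 *)
Definition Omega (v : R) (w q : R * R) : R :=
  `|v| ^+ 2 + `|w.1| ^+ 2 + `|w.2| ^+ 2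
  - `|q.1| ^+ 2 - `|q.2| ^+ 2 - `|v5_of v w q| ^+ 2.

Definition collision_integrand (f : R -> R -> R -> R) (t x v : R)
    (w q : R * R) : R :=
  let f0 := f t x v in
  let f1 := f t x w.1 in
  let f2 := f t x w.2 in
  let f3 := f t x q.1 in
  let f4 := f t x q.2 in
  let f5 := f t x (v5_of v w q) in
  f3 * f4 * f5 * (f0 * f1 + f0 * f2 + f1 * f2)
  - f0 * f1 * f2 * (f3 * f4 + f3 * f5 + f4 * f5).

Definition C6 (f : R -> R -> R -> R) (t x v : R) : \bar R :=
  (\int[lebesgue_measure \x lebesgue_measure]_w
     delta_integral (Omega v w) (collision_integrand f t x v w))%E.

(* the oriented integral from 0 to t *)
Definition integral_0 (F : R -> \bar R) (t : R) : \bar R :=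
  if 0 <= t then (\int[lebesgue_measure]_(s in `[0%R, t]) F s)%E
  else (- \int[lebesgue_measure]_(s in `[t, 0%R]) F s)%E.

(* The Duhamel identity is stated in \bar R; as its left-hand side is finite,
   so is the time integral on the right-hand side. *)
Definition mild_solution (alpha beta : R) (f0 : R -> R -> R)
    (f : R -> R -> R -> R) : Prop :=
  [/\ jointly_measurable f,
      Linfty_M alpha beta (along_flow f)
    & forall t x v, (along_flow f t x v)%:E =
        ((f0 x v)%:E
         + integral_0 (fun s => transport (- s) (C6 f) s x v) t)%E].

Definition C1_beta (C1 beta : R) : R :=
  2 `^ (- (1 / 2)) * C1 * (beta^-1 + 1).

End wave_kinetic.

(* Main.v *)
From HB Require Import structures.
Require Import Defs.
From mathcomp Require Import all_boot all_order all_algebra.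
From mathcomp Require Import all_classical all_reals all_analysis.
From mathcomp Require Import measurable_realfun.
From mathcomp Require Import ring lra.
Set Implicit Arguments.
Unset Strict Implicit.
Unset Printing Implicit Defensive.
Import Order.TTheory GRing.Theory Num.Theory.
Import numFieldNormedType.Exports.
Local Open Scope classical_set_scope.
Local Open Scope ring_scope.

(** For fixed [v, v1, v2] the zero set of [Omega] is the image of the fixed
    ellipse [a^2 + a b + b^2 = 3] under a homothety. The length H^1 and the
    gradient of [Omega] both scale by its ratio, which therefore cancels:
    integration against [delta(Omega)] is integration of a bounded weight
    against one finite measure on the fixed ellipse, and the collision operator
    is jointly measurable. No formula for H^1 is needed, only that it is a
    measure on Borel sets (Caratheodory's criterion), that it scales, and that
    the ellipse, a Lipschitz curve, has finite length.

    On the resonant set the weights [E = exp(-(alpha (x - t v)^2 + beta v^2))],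
    which are carried by free transport, satisfy [E3 E4 E5 = E E1 E2]; hence
    every term of the collision integrand is at most [E E1 E2] times a product
    of five amplitudes. At a fixed time [s] the Gaussian integral of [E1 E2] in
    [v1, v2] is at most [pi / (alpha s^2 + beta)], whose integral in [s] is at
    most [pi / sqrt (alpha beta)]. The Duhamel map is therefore a contraction of
    ratio 1/2 on the ball of radius [2 R_e], as [beta^(-1/2) <= beta^(-1) + 1]. *)

(** * The Hausdorff measure of dimension one *)

Section hausdorff_outer_measure.
Context {R : realType}.
Implicit Types (p q : R * R) (A B U : set (R * R)) (d e : R).

Lemma euclid_dist_ge_fst p q : `|p.1 - q.1| <= euclid_dist p q.
Proof. by rewrite -sqrtr_sqr ler_wsqrtr// lerDl sqr_ge0. Qed.

Lemma euclid_dist_ge_snd p q : `|p.2 - q.2| <= euclid_dist p q.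
Proof. by rewrite -sqrtr_sqr ler_wsqrtr// lerDr sqr_ge0. Qed.

Lemma euclid_diam_ge0 A : (0 <= euclid_diam A)%E.
Proof. by apply: ereal_sup_ubound; left. Qed.

Lemma euclid_diam_ub A p q : A p -> A q -> ((euclid_dist p q)%:E <= euclid_diam A)%E.
Proof. by move=> Ap Aq; apply: ereal_sup_ubound; right; exists (p, q). Qed.

Lemma euclid_diam_le A d : 0 <= d ->
  (forall p q, A p -> A q -> euclid_dist p q <= d) -> (euclid_diam A <= d%:E)%E.
Proof.
move=> d0 Ad; apply: ge_ereal_sup => _ [->|[[p q] [/= Ap Aq] <-]].
  by rewrite lee_fin.
by rewrite lee_fin; exact: Ad.
Qed.

Lemma euclid_diam0 : euclid_diam (set0 : set (R * R)) = 0%E.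
Proof.
by apply/eqP; rewrite eq_le euclid_diam_ge0 andbT; exact: euclid_diam_le.
Qed.

(** The value [+oo] above diameter [d] encodes the size restriction, so that [hausdorff1_delta]
    becomes the outer measure generated by a set function. *)
Definition diam_gauge d A : \bar R :=
  if (euclid_diam A <= d%:E)%E then euclid_diam A else +oo%E.

Lemma diam_gauge_ge0 d A : (0 <= diam_gauge d A)%E.
Proof. by rewrite /diam_gauge; case: ifP => // _; exact: euclid_diam_ge0. Qed.

Lemma diam_gauge0 d : 0 <= d -> diam_gauge d set0 = 0%E.
Proof. by move=> d0; rewrite /diam_gauge euclid_diam0 lee_fin d0. Qed.

(* In [g_sigma_algebraType setT] every set is measurable, so that [mu_ext]
   ranges over all coverings. *)
Lemma hausdorff1_deltaE d A : hausdorff1_delta d A =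
  @mu_ext _ (g_sigma_algebraType [set: set (R * R)]) R (diam_gauge d) A.
Proof.
apply/eqP; rewrite eq_le; apply/andP; split; last first.
  apply: ereal_inf_le_tmp => _ [U [AU Ud] <-]; exists U.
    by split=> // i; exact: sub_sigma_algebra.
  by apply: eq_eseriesr => i _; rewrite /diam_gauge Ud.
apply: le_ereal_inf_tmp => _ [U [_ AU] <-].
(* A covering with an oversized piece has infinite gauge sum; any other covering is admissible. *)
have [[k kd]|] := pselect (exists k, ~~ (euclid_diam (U k) <= d%:E)%E).
  rewrite (@eseries_pinfty _ _ _ k) ?leey//.
    by move=> n _; rewrite -ltNye (lt_le_trans _ (diam_gauge_ge0 _ _)).
  by rewrite /diam_gauge (negbTE kd).
move=> /forallNP/(_ _)/negP => Ud.
apply: ereal_inf_lbound; exists U.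
  by split=> // k; have := Ud k; rewrite negbK.
by apply: eq_eseriesr => i _; rewrite /diam_gauge; have := Ud i; rewrite negbK => ->.
Qed.

Lemma hausdorff1_delta_ge0 d A : (0 <= hausdorff1_delta d A)%E.
Proof. by rewrite hausdorff1_deltaE mu_ext_ge0//; exact: diam_gauge_ge0. Qed.

Lemma hausdorff1_delta_noninc d e A : d <= e ->
  (hausdorff1_delta e A <= hausdorff1_delta d A)%E.
Proof.
move=> de; apply: ereal_inf_le_tmp => _ [U [AU Ud] <-]; exists U => //.
by split=> // k; rewrite (le_trans (Ud k))// lee_fin.
Qed.

Lemma hausdorff1_delta_le d A : 0 < d ->
  (hausdorff1_delta d A <= hausdorff1 A)%E.
Proof. by move=> d0; apply: ereal_sup_ubound; exists d. Qed.

Lemma hausdorff1_ge0 A : (0 <= hausdorff1 A)%E.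
Proof. exact: le_trans (hausdorff1_delta_ge0 _ _) (@hausdorff1_delta_le 1 A ltr01). Qed.

Lemma hausdorff1_set0 : hausdorff1 (set0 : set (R * R)) = 0%E.
Proof.
apply/eqP; rewrite eq_le hausdorff1_ge0 andbT.
apply: ge_ereal_sup => _ [d /= d0 <-]; rewrite hausdorff1_deltaE mu_ext0//.
  by apply: diam_gauge0; exact: ltW.
exact: diam_gauge_ge0.
Qed.

Lemma le_hausdorff1 : {homo @hausdorff1 R : A B / A `<=` B >-> (A <= B)%E}.
Proof.
move=> A B AB; apply: ge_ereal_sup => _ [d d0 <-].
apply: (@le_trans _ _ (hausdorff1_delta d B)); last exact: hausdorff1_delta_le.
by rewrite !hausdorff1_deltaE; exact: le_mu_ext.
Qed.

Lemma hausdorff1_sigma_subadditive : sigma_subadditive (@hausdorff1 R).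
Proof.
move=> F; apply: ge_ereal_sup => _ [d d0 <-].
rewrite hausdorff1_deltaE.
have /= := @mu_ext_sigma_subadditive _
  (g_sigma_algebraType [set: set (R * R)]) R (diam_gauge d)
  (diam_gauge_ge0 d) F.
move=> /le_trans; apply; apply: lee_nneseries => k _.
  by rewrite mu_ext_ge0//; exact: diam_gauge_ge0.
by rewrite -hausdorff1_deltaE; exact: hausdorff1_delta_le.
Qed.

HB.instance Definition _ := isOuterMeasure.Build R (R * R)%type (@hausdorff1 R)
  hausdorff1_set0 hausdorff1_ge0 le_hausdorff1 hausdorff1_sigma_subadditive.

(** A piece of diameter at most [d < e] cannot meet both [A] and [B], so a covering splits: [V]
    keeps the pieces that meet [A], [W] the others. *)
Lemma hausdorff1_delta_separated d e A B : d < e ->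
  (forall p q, A p -> B q -> e <= euclid_dist p q) ->
  (hausdorff1_delta d A + hausdorff1_delta d B <= hausdorff1_delta d (A `|` B))%E.
Proof.
move=> de AB; apply: le_ereal_inf_tmp => _ [U [ABU Ud] <-].
pose V k := if `[< U k `&` A !=set0 >] then U k else set0.
pose W k := if `[< U k `&` A !=set0 >] then set0 else U k.
have VW k : (euclid_diam (U k) = euclid_diam (V k) + euclid_diam (W k))%E.
  by rewrite /V /W; case: ifP; rewrite euclid_diam0 (adde0, add0e).
under eq_eseriesr do rewrite VW.
rewrite nneseriesD; [|by move=> *; exact: euclid_diam_ge0..].
apply: leeD; apply: ereal_inf_lbound.
- exists V => //; split=> [p Ap|k]; last first.
    rewrite /V; case: ifP => // _; rewrite euclid_diam0.
    exact: le_trans (euclid_diam_ge0 _) (Ud k).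
  have [k _ Ukp] := ABU p (or_introl Ap); exists k => //; rewrite /V.
  by case: asboolP => // -[]; exists p.
- exists W => //; split=> [q Bq|k]; last first.
    rewrite /W; case: ifP => // _; rewrite euclid_diam0.
    exact: le_trans (euclid_diam_ge0 _) (Ud k).
  have [k _ Ukq] := ABU q (or_intror Bq); exists k => //; rewrite /W.
  case: asboolP => // -[p [Ukp Ap]].
  have := le_trans (euclid_diam_ub Ukp Ukq) (Ud k).
  by rewrite lee_fin leNgt (lt_le_trans de (AB _ _ Ap Bq)).
Qed.

Lemma hausdorff1_separated e A B : 0 < e ->
  (forall p q, A p -> B q -> e <= euclid_dist p q) ->
  (hausdorff1 A + hausdorff1 B <= hausdorff1 (A `|` B))%E.
Proof.
move=> e0 AB.
have [->|fin] := eqVneq (hausdorff1 (A `|` B)) +oo%E; first by rewrite leey.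
have fN : hausdorff1 (A `|` B) \is a fin_num.
  by rewrite ge0_fin_numE ?hausdorff1_ge0// ltey.
have fA : hausdorff1 A \is a fin_num.
  rewrite ge0_fin_numE ?hausdorff1_ge0//.
  by apply: le_lt_trans (le_hausdorff1 (@subsetUl _ A B)) _; rewrite ltey.
rewrite -leeBrDl//; apply: ge_ereal_sup => _ [b /= b0 <-].
have fb : hausdorff1_delta b B \is a fin_num.
  rewrite ge0_fin_numE ?hausdorff1_delta_ge0//.
  apply: le_lt_trans (hausdorff1_delta_le _ b0) _.
  by apply: le_lt_trans (le_hausdorff1 (@subsetUr _ A B)) _; rewrite ltey.
rewrite leeBrDl// -leeBrDr//; apply: ge_ereal_sup => _ [a /= a0 <-].
rewrite leeBrDr//.
(* Passing to a scale below [a] and [b] only raises the two terms; a scale below [e] makes the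
   separation effective. *)
pose d := Num.min a (Num.min b (e / 2)).
have d0 : 0 < d by rewrite !lt_min a0 b0 divr_gt0.
apply: (le_trans _ (hausdorff1_delta_le _ d0)).
apply: le_trans (hausdorff1_delta_separated (d := d) _ AB).
  apply: leeD; apply: hausdorff1_delta_noninc.
    by rewrite /d ge_min lexx.
  by rewrite /d !ge_min lexx orbT.
by rewrite /d !gt_min (_ : e / 2 < e) ?orbT//; lra.
Qed.

End hausdorff_outer_measure.

(** * Caratheodory measurability of sublevel sets of 1-Lipschitz functions *)

Section caratheodory_criterion.
Context {R : realType}.
Implicit Types (p q : R * R) (X : set (R * R)) (c : R).
Variable phi : R * R -> R.
Hypothesis phi_lip : forall p q, `|phi p - phi q| <= euclid_dist p q.

Lemma hausdorff1_gap (r s : R) X : r < s ->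
  (hausdorff1 (X `&` [set p | phi p <= r]%R) +
   hausdorff1 (X `&` [set p | s <= phi p]%R) <= hausdorff1 X)%E.
Proof.
move=> rs; apply: le_trans (hausdorff1_separated (e := s - r) _ _) _.
- by rewrite subr_gt0.
- move=> p q [_ /= pr] [_ /= qs]; apply: le_trans (phi_lip _ _).
  by rewrite distrC (le_trans _ (ler_norm _))// lerB.
- by apply: le_hausdorff1 => p [] [].
Qed.

Let r c n : R := c - n.+1%:R^-1.

Let r_lt c n : r c n < r c n.+1.
Proof. by rewrite /r ltrD2l ltrN2 ltf_pV2 ?posrE ?ltr0n// ltr_nat. Qed.

Let r_le c m n : (m <= n)%N -> r c m <= r c n.
Proof. by move=> mn; rewrite /r lerD2l lerN2 lef_pV2 ?posrE ?ltr0n// ler_nat. Qed.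

Let r_lt_lim c n : r c n < c.
Proof. by rewrite /r ltrBlDr ltrDl invr_gt0. Qed.

(** The index is shifted so that the gap from [r c n] to [r c n.+1] separates [layer c X n] from
    [below c X n]. *)
Let layer c X n := X `&` [set p | r c n.+1 < phi p <= r c n.+2].

Let below c X n := X `&` [set p | phi p <= r c n].

(* Layers of equal parity are separated. *)
Let layer_sum c X n :
  (\sum_(0 <= k < n.*2) hausdorff1 (layer c X k) <=
   hausdorff1 (below c X n.*2) + hausdorff1 (below c X n.*2.+1))%E.
Proof.
have step k : (hausdorff1 (below c X k) + hausdorff1 (layer c X k) <=
               hausdorff1 (below c X k.+2))%E.
  apply: le_trans (hausdorff1_gap _ (r_lt c k)).
  apply: leeD; apply: le_hausdorff1 => p [Xp /=].
    move=> pk; split; last exact: pk.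
    split => //=; apply: (le_trans pk); apply/ltW.
    exact: lt_trans (r_lt _ _) (r_lt _ _).
  by move=> /andP[pk pk']; split; [split|exact: ltW].
elim: n => [|n ih].
  by rewrite big_nil adde_ge0// hausdorff1_ge0.
rewrite doubleS !big_nat_recr//=.
apply: (@le_trans _ _ ((hausdorff1 (below c X n.*2) + hausdorff1 (below c X n.*2.+1))
  + hausdorff1 (layer c X n.*2) + hausdorff1 (layer c X n.*2.+1))%E).
  by do 2 apply: leeD => //.
rewrite [X in (X + _ <= _)%E]addeAC -addeA.
by apply: leeD; exact: step.
Qed.

(** The layers approach the level [c] with summable measure. Up to a small tail, the part of [X]
    below [c] therefore lies in some [below c X n.+1], which a gap separates from the part at or
    above [c]. *)
Lemma caratheodory_halfplane c :
  caratheodory_measurable (@hausdorff1 R) [set p | phi p < c].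
Proof.
apply: le_caratheodory_measurable => X /=.
have [->|Xoo] := eqVneq (hausdorff1 X) +oo%E; first by rewrite leey.
(* By [layer_sum] the partial sums are at most twice [hausdorff1 X]. *)
have layer_fin : (\sum_(0 <= k <oo) hausdorff1 (layer c X k) < +oo)%E.
  apply: (@le_lt_trans _ _ (hausdorff1 X + hausdorff1 X)%E); last first.
    by rewrite lte_add_pinfty// ltey.
  apply: lime_le; first by apply: is_cvg_nneseries => n _ _; exact: hausdorff1_ge0.
  apply: nearW => n; apply: (@le_trans _ _ (\sum_(0 <= k < n.*2) hausdorff1 (layer c X k))%E).
    apply: lee_sum_nneg_natr => //; last by rewrite -addnn leq_addr.
    by move=> *; exact: hausdorff1_ge0.
  by apply: le_trans (layer_sum _ _ _) _; apply: leeD; apply: le_hausdorff1 => p [].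
have tail := nneseries_tail_cvg layer_fin (fun k _ => hausdorff1_ge0 _).
apply/lee_addgt0Pr => e e0.
have /tail [n _ /(_ n (leqnn n))/= tail_n] : nbhs (0 : \bar R)%E [set x | (x < e%:E)%E].
  by apply: open_nbhs_nbhs; split => //=; exact: open_ereal_lt_ereal.
apply: (@le_trans _ _ (hausdorff1 (below c X n.+1)
   + \sum_(n <= k <oo) hausdorff1 (layer c X k)
   + hausdorff1 (X `&` ~` [set p | phi p < c]%R))%E).
  rewrite leeD2r//.
  apply: le_trans (leeD2l _ (outer_measure_sigma_subadditive_tail _ _ _)).
  apply: le_trans (outer_measureU2 _ _ _).
  apply: le_hausdorff1 => p [Xp /= pc].
  have [pn|np] := leP (phi p) (r c n.+1); first by left.
  right.
  (* The least [k] with [P k] is the index of the layer containing [p]; when it is 0, the lower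
     bound of that layer comes from [np]. *)
  pose P k := phi p <= r c k.+2.
  have exP : exists k, P k.
    exists (Num.truncn ((c - phi p)^-1)); rewrite /P /r lerBrDr -lerBrDl.
    rewrite invf_ple ?posrE ?subr_gt0//; apply/ltW.
    apply: (lt_le_trans (truncnS_gt _)); rewrite ler_nat.
    by apply: leqW; apply: leqW.
  case: (ex_minnP exP) => m Pm minm.
  exists m; last first.
    split=> //=; rewrite [X in _ && X]Pm andbT ltNge; apply/negP => pm.
    case: m Pm minm pm => [|m] Pm minm pm; last by have := minm _ pm; rewrite ltnn.
    by move: np; rewrite ltNge (le_trans pm)// r_le.
  move=> /= mn; move: np; rewrite ltNge => /negP; apply; apply: (le_trans Pm).
  by rewrite r_le.
rewrite addeAC -[leRHS]addeC addeC; apply: leeD; first exact: ltW.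
apply: le_trans (hausdorff1_gap _ (r_lt_lim c n.+1)).
apply: leeD; apply: le_hausdorff1 => p [Xp /=] //.
by move=> /negP; rewrite -leNgt.
Qed.

End caratheodory_criterion.

(** * Borel measurability, scaling, and the length of Lipschitz curves *)

Section hausdorff_measure.
Context {R : realType}.

(** The coordinates are 1-Lipschitz, hence measurable for the Caratheodory sigma-algebra; so is the
    identity, as the pair of its coordinates. *)
Lemma measurable_caratheodory_hausdorff1 (A : set (R * R)) :
  measurable A -> caratheodory_measurable (@hausdorff1 R) A.
Proof.
move=> mA.
have mphi (phi : R * R -> R) : (forall p q, `|phi p - phi q| <= euclid_dist p q) ->
    measurable_fun [set: caratheodory_type (@hausdorff1 R)] phi.
  move=> phi_lip; apply: (measurability _ (RGenInftyO.measurableE R)).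
  move=> _ [_ [c ->] <-]; rewrite setTI.
  rewrite (_ : _ @^-1` _ = [set p | phi p < c]); first exact: caratheodory_halfplane.
  by apply/seteqP; split => p /=; rewrite in_itv.
have mid : measurable_fun [set: caratheodory_type (@hausdorff1 R)]
    (fun p => (p.1, p.2) : R * R).
  by apply: measurable_fun_pair; apply: mphi;
    [exact: euclid_dist_ge_fst|exact: euclid_dist_ge_snd].
have := mid measurableT _ mA; rewrite setTI.
by rewrite (_ : _ @^-1` A = A)//; apply/seteqP; split => -[].
Qed.

Lemma hausdorff1_semi_sigma_additive :
  semi_sigma_additive (@hausdorff1 R : set (R * R) -> \bar R).
Proof.
move=> F mF tF mUF.
by apply: (@caratheodory_measure_sigma_additive R (R * R)%type hausdorff1) => // [i|];
  exact: measurable_caratheodory_hausdorff1.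
Qed.

HB.instance Definition _ := isMeasure.Build _ (R * R)%type R (@hausdorff1 R)
  hausdorff1_set0 hausdorff1_ge0 hausdorff1_semi_sigma_additive.

(** A covering of [A] at scale [L^-1 * d] is carried to a covering of the image at scale [d], with
    diameters multiplied by at most [L]. *)
Lemma hausdorff1_image_le (L : R) (phi : R * R -> R * R) (A : set (R * R)) :
  0 < L -> (forall p q, euclid_dist (phi p) (phi q) <= L * euclid_dist p q) ->
  (hausdorff1 (phi @` A) <= L%:E * hausdorff1 A)%E.
Proof.
move=> L0 phi_lip; apply: ge_ereal_sup => _ [d /= d0 <-].
have dL : 0 < L^-1 * d by rewrite mulr_gt0 ?invr_gt0.
apply: (@le_trans _ _ (L%:E * hausdorff1_delta (L^-1 * d) A)%E); last first.
  by rewrite lee_wpmul2l ?lee_fin ?(ltW L0)//; exact: hausdorff1_delta_le.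
rewrite -lee_pdivrMl//; apply: le_ereal_inf_tmp => _ [U [AU Ud] <-].
have diam_phi k : (euclid_diam (phi @` U k) <= L%:E * euclid_diam (U k))%E.
  apply: ge_ereal_sup => _ [->|[[_ _] [/= [p Up <-] [q Uq <-]] <-]].
    by rewrite mule_ge0 ?lee_fin ?(ltW L0)// euclid_diam_ge0.
  apply: (@le_trans _ _ (L * euclid_dist p q)%:E); first by rewrite lee_fin.
  by rewrite EFinM lee_wpmul2l ?lee_fin ?(ltW L0)//; exact: euclid_diam_ub.
rewrite lee_pdivrMl// -nneseriesZl; last by move=> *; exact: euclid_diam_ge0.
apply: (@le_trans _ _ (\sum_(0 <= k <oo) euclid_diam (phi @` U k))%E).
  apply: ereal_inf_lbound; exists (fun k => phi @` U k) => //; split.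
    by move=> _ [p Ap <-]; have [k _ Ukp] := AU p Ap; exists k => //; exists p.
  move=> k; apply: le_trans (diam_phi k) _.
  by rewrite -lee_pdivlMl// -EFinM.
by apply: lee_nneseries => k *; [exact: euclid_diam_ge0|exact: diam_phi].
Qed.

Definition homothety (c : R * R) (r : R) (q : R * R) : R * R :=
  (c.1 + r * q.1, c.2 + r * q.2).

Lemma euclid_dist_homothety c r p q : 0 <= r ->
  euclid_dist (homothety c r p) (homothety c r q) = r * euclid_dist p q.
Proof.
move=> r0; rewrite /euclid_dist /=.
rewrite (_ : _ ^+ 2 + _ ^+ 2 = r ^+ 2 * ((p.1 - q.1) ^+ 2 + (p.2 - q.2) ^+ 2)); last by ring.
by rewrite sqrtrM ?sqr_ge0// sqrtr_sqr ger0_norm.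
Qed.

(** The homothety and its inverse are Lipschitz with constants [r] and [r^-1]; each gives one of the
    two inequalities. *)
Lemma hausdorff1_homothety c r (A : set (R * R)) : 0 < r ->
  (r%:E * hausdorff1 (homothety c r @^-1` A))%E = hausdorff1 A.
Proof.
move=> r0; pose c' := (- (r^-1 * c.1), - (r^-1 * c.2)).
have hK : cancel (homothety c r) (homothety c' r^-1).
  by move=> [a b]; congr (_, _); rewrite /=; field; exact: lt0r_neq0.
have h'K : cancel (homothety c' r^-1) (homothety c r).
  by move=> [a b]; congr (_, _); rewrite /=; field; exact: lt0r_neq0.
have imE : homothety c r @^-1` A = homothety c' r^-1 @` A.
  apply/seteqP; split=> [p Ap|_ [p Ap <-]]; last by rewrite /= h'K.
  by exists (homothety c r p).
have imE' : A = homothety c r @` (homothety c r @^-1` A).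
  apply/seteqP; split=> [p Ap|_ [p Ap <-] //].
  by exists (homothety c' r^-1 p); rewrite /= h'K.
apply/eqP; rewrite eq_le; apply/andP; split.
  rewrite -lee_pdivlMl// imE; apply: hausdorff1_image_le; rewrite ?invr_gt0//.
  by move=> p q; rewrite euclid_dist_homothety// invr_ge0 ltW.
rewrite [in leLHS]imE'; apply: hausdorff1_image_le => // p q.
by rewrite euclid_dist_homothety// ltW.
Qed.

Lemma hausdorff1_curve_le (L a b : R) (g : R -> R * R) : 0 <= L -> a < b ->
  (forall s t, euclid_dist (g s) (g t) <= L * `|s - t|) ->
  (hausdorff1 (g @` `[a, b[) <= (L * (b - a))%:E)%E.
Proof.
move=> L0 ab gL; apply: ge_ereal_sup => _ [d /= d0 <-].
have ba0 : 0 < b - a by rewrite subr_gt0.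
(* [N] exceeds [L * (b - a) / d], so the image of each of the [N] pieces of length [l] has diameter
   at most [L * l <= d]. *)
pose N := (Num.truncn (L * (b - a) / d)).+1.
have N0 : 0 < N%:R :> R by rewrite ltr0n.
pose l := (b - a) / N%:R.
have l0 : 0 < l by rewrite divr_gt0.
have Lld : L * l <= d.
  rewrite /l mulrA ler_pdivrMr// [leRHS]mulrC -ler_pdivrMr//.
  exact/ltW/truncnS_gt.
pose U k := if (k < N)%N then g @` `[a + k%:R * l, a + k.+1%:R * l] else set0.
have diamU k : (euclid_diam (U k) <= (if (k < N)%N then L * l else 0)%:E)%E.
  rewrite /U; case: ifP => _; last by rewrite euclid_diam0.
  apply: euclid_diam_le; first by rewrite mulr_ge0// ltW.
  move=> _ _ [s /= + <-] [t /= + <-]; rewrite !in_itv/= => /andP[s1 s2] /andP[t1 t2].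
  apply: le_trans (gL _ _) _; rewrite ler_wpM2l// ler_distl.
  by move: s1 s2 t1 t2; rewrite -natr1 mulrDl mul1r => *; apply/andP; split; lra.
apply: (@le_trans _ _ (\sum_(0 <= k <oo) euclid_diam (U k))%E).
  apply: ereal_inf_lbound; exists U => //; split; last first.
    move=> k; apply: le_trans (diamU k) _; rewrite lee_fin.
    by case: ifP => // _; exact: ltW.
  move=> _ [s /= + <-]; rewrite in_itv/= => /andP[as_ sb].
  have sl0 : 0 <= (s - a) / l by rewrite divr_ge0 ?subr_ge0// ltW.
  (* The integer part locates the piece containing [s]; the strict bound [s < b] keeps it below
     [N]. *)
  pose k := Num.truncn ((s - a) / l).
  have kN : (k < N)%N.
    rewrite -(ltr_nat R); apply: (@le_lt_trans _ _ ((s - a) / l)).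
      by rewrite truncn_le.
    rewrite ltr_pdivrMr// /l mulrC divfK ?gt_eqF//.
    by rewrite ltrD2r.
  exists k => //; rewrite /U kN; exists s => //=; rewrite in_itv/=.
  have /andP[k1 k2] := truncn_itv sl0.
  move: k1 k2; rewrite -/k ler_pdivlMr// ltr_pdivrMr// => k1 k2.
  by apply/andP; split; lra.
rewrite (nneseries_split 0 N); last by move=> *; exact: euclid_diam_ge0.
rewrite add0n [X in (_ + X)%E]eseries0 ?adde0; last first.
  by move=> k Nk _; rewrite /U ltnNge Nk euclid_diam0.
rewrite big_mkord; apply: (@le_trans _ _ (\sum_(k < N) (L * l)%:E)%E).
  by apply: lee_sum => k _; have := diamU k; rewrite ltn_ord.
rewrite sumEFin lee_fin sumr_const card_ord -mulr_natr -mulrA /l divfK//.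
exact: lt0r_neq0.
Qed.

End hausdorff_measure.

(** * The ellipse and its finite length *)

Section ellipse.
Context {R : realType}.
Implicit Types (q : R * R).

Definition ellipse_form q : R := q.1 ^+ 2 + q.1 * q.2 + q.2 ^+ 2.

Definition ellipse : set (R * R) := [set q | ellipse_form q = 3].

Lemma measurable_ellipse_form : measurable_fun setT ellipse_form.
Proof.
by apply: measurable_funD; [apply: measurable_funD|];
  rewrite /= ?expr2; apply: measurable_funM => //; apply: measurable_funX.
Qed.

Lemma measurable_ellipse : measurable ellipse.
Proof.
rewrite -[ellipse]setTI.
exact: (measurable_ellipse_form measurableT (measurable_set1 3)).
Qed.

Lemma cos_lipschitz (s t : R) : `|cos s - cos t| <= `|s - t|.
Proof.
wlog ts : s t / t <= s.
  move=> h; have [ts|/ltW st] := leP t s; first exact: h.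
  by rewrite distrC (distrC s); exact: h.
have [|c _ ->] := @MVT_segment R cos (fun x => - sin x) t s ts.
  by apply: continuous_subspaceT; exact: continuous_cos.
by rewrite normrM normrN ler_piMl//; exact: sin_max.
Qed.

Lemma sin_lipschitz (s t : R) : `|sin s - sin t| <= `|s - t|.
Proof.
have := cos_lipschitz (s - pi / 2) (t - pi / 2).
by rewrite !cosBpihalf opprB addrA addrNK.
Qed.

(** [acos x] is the angle up to its sign, which is chosen as that of [y]. *)
Lemma circle_param (x y : R) : x ^+ 2 + y ^+ 2 = 1 ->
  exists2 s, - pi <= s <= pi & x = cos s /\ y = sin s.
Proof.
move=> xy.
have x1 : -1 <= x <= 1 by apply/andP; split; nra.
have sy : sin (acos x) = `|y|.
  by rewrite sin_acos// -xy addrC addKr sqrtr_sqr.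
have := acos_ge0 x1; have := acos_lepi x1; have := @pi_ge0 R => p0 ap a0.
have [y0|y0] := leP 0 y.
  exists (acos x); first by apply/andP; split; lra.
  by rewrite acosK// sy ger0_norm.
exists (- acos x); first by apply/andP; split; lra.
by rewrite cosN sinN acosK// sy ltr0_norm// opprK.
Qed.

Lemma hausdorff1_ellipse_lty : (hausdorff1 ellipse < +oo)%E.
Proof.
pose s3 : R := Num.sqrt 3.
have s30 : 0 < s3 by rewrite sqrtr_gt0.
have s3E : s3 ^+ 2 = 3 by rewrite sqr_sqrtr.
have s32 : s3 <= 2 by nra.
(* Diagonalising coordinates: the half sum of the components is [cos s] and the half difference is
   [s3 * sin s], so [ellipse_form] is 3 along the curve. *)
pose g (s : R) := (cos s + s3 * sin s, cos s - s3 * sin s).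
(* The squared increment is at most 8 times the square of [s - t]; the constant 6 is a crude
   bound. *)
have gL s t : euclid_dist (g s) (g t) <= 6 * `|s - t|.
  have c1 := cos_lipschitz s t; have s1 := sin_lipschitz s t.
  rewrite -[leRHS]ger0_norm ?mulr_ge0// -[leRHS]sqrtr_sqr ler_wsqrtr//=.
  have sqr_le (u : R) : `|u| <= `|s - t| -> u ^+ 2 <= `|s - t| ^+ 2.
    by move=> us; rewrite -real_normK ?num_real// lerXn2r ?nnegrE.
  rewrite (_ : _ + _ = 2 * (cos s - cos t) ^+ 2
    + 2 * s3 ^+ 2 * (sin s - sin t) ^+ 2); last by ring.
  rewrite s3E exprMn; have := sqr_le _ c1; have := sqr_le _ s1.
  have := sqr_ge0 `|s - t|; lra.
(* The half-open parameter interval runs past [pi] so as to contain the endpoint [pi] of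
   [circle_param]. *)
have /le_lt_trans : (hausdorff1 (g @` `[(- pi)%R, (pi + 1)%R[) <= (6 * (pi + 1 - - pi))%:E)%E.
  apply: hausdorff1_curve_le => //.
  by have := @pi_ge0 R; lra.
move=> /(_ _ (ltry _)); apply: le_lt_trans; apply: le_hausdorff1 => -[a b].
rewrite /ellipse/ellipse_form/= => ab.
have [|s /andP[s1 s2] [cE sE]] := @circle_param ((a + b) / 2) ((a - b) / (2 * s3)).
  rewrite !expr_div_n exprMn s3E.
  rewrite (_ : _ + _ = (a ^+ 2 + a * b + b ^+ 2) / 3); last by field.
  by rewrite ab divff.
exists s.
  by rewrite /= in_itv/= s1/= (le_lt_trans s2)// ltrDl.
by rewrite /g -cE -sE; congr (_, _); field; exact: lt0r_neq0.
Qed.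

End ellipse.

(** * Integration over the resonant set *)

(** Inversion is continuous away from 0, and the single point 0, where it takes the default value 0,
    is treated apart. *)
Lemma measurable_invr {R : realType} : measurable_fun setT (@GRing.inv R).
Proof.
rewrite -(setUv [set 0 : R]); apply/measurable_funU => //.
  exact: measurableC.
split; first by apply: measurable_fun_set1.
apply: open_continuous_measurable_fun.
  by apply: closed_openC; exact: closed_eq.
by move=> x; rewrite inE/= => /eqP x0; exact: inv_continuous.
Qed.

(** With one of [v3], [v4] fixed, [Omega] is a polynomial of this form in the other. *)
Lemma derive1_quadratic {R : realType} (k0 k1 x : R) :
  derive1 (fun y => k0 + k1 * y - 2 * y ^+ 2) x = k1 - 4 * x.
Proof.
rewrite derive1E (_ : (fun y => _) = (cst k0 + k1 *: id - 2 *: id ^+ 2))//.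
have d := is_deriveB (is_deriveD (is_derive_cst k0 x (1 : R))
  (is_deriveZ k1 (is_derive_id x (1 : R))))
  (is_deriveZ 2 (is_deriveX 2 (is_derive_id x (1 : R)))).
rewrite (@derive_val _ _ _ _ _ _ _ d) /= expr1.
by change (0 + k1 * 1 - 2 * (2 * x * 1) = k1 - 4 * x); ring.
Qed.

(** * Parametrisation of the resonant set by the ellipse *)

Section resonant_ellipse.
Context {R : realType}.
Implicit Types (v : R) (w p q : R * R) (F : R * R -> R).

(** The critical point of [Omega v w], where [v3 = v4 = v5]. *)
Definition Omega_center v w : R * R :=
  ((v + w.1 + w.2) / 3, (v + w.1 + w.2) / 3).

Definition Omega_radius v w : R :=
  Num.sqrt ((v ^+ 2 + w.1 ^+ 2 + w.2 ^+ 2 - v * w.1 - v * w.2 - w.1 * w.2) / 9).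

Definition resonant_pair v w q : R * R :=
  homothety (Omega_center v w) (Omega_radius v w) q.

Lemma Omega_radius_sqr v w : Omega_radius v w ^+ 2 =
  (v ^+ 2 + w.1 ^+ 2 + w.2 ^+ 2 - v * w.1 - v * w.2 - w.1 * w.2) / 9.
Proof.
rewrite sqr_sqrtr// divr_ge0//.
have := sqr_ge0 (v - w.1); have := sqr_ge0 (v - w.2); have := sqr_ge0 (w.1 - w.2).
rewrite !sqrrB; lra.
Qed.

Lemma Omega_homothety v w s q : Omega v w (homothety (Omega_center v w) s q) =
  6 * Omega_radius v w ^+ 2 - 2 * s ^+ 2 * ellipse_form q.
Proof.
rewrite Omega_radius_sqr /Omega /v5_of /ellipse_form /=.
by rewrite !real_normK ?num_real//; field.
Qed.

(** The Euclidean norm of the gradient of [ellipse_form]. *)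
Definition ellipse_slope q : R :=
  Num.sqrt ((2 * q.1 + q.2) ^+ 2 + (q.1 + 2 * q.2) ^+ 2).

Lemma grad_norm_Omega v w s q : 0 <= s ->
  grad_norm (Omega v w) (homothety (Omega_center v w) s q) = 2 * s * ellipse_slope q.
Proof.
move=> s0; rewrite /grad_norm.
have D1 (a b : R) : derive1 (fun a : R => Omega v w (a, b)) a =
    2 * (v + w.1 + w.2 - b) - 4 * a.
  rewrite -(derive1_quadratic (v ^+ 2 + w.1 ^+ 2 + w.2 ^+ 2 - b ^+ 2
    - (v + w.1 + w.2 - b) ^+ 2)); congr (derive1 _ a); apply/funext => x.
  by rewrite /Omega /v5_of /= !real_normK ?num_real//; ring.
have D2 (a b : R) : derive1 (fun b : R => Omega v w (a, b)) b =
    2 * (v + w.1 + w.2 - a) - 4 * b.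
  rewrite -(derive1_quadratic (v ^+ 2 + w.1 ^+ 2 + w.2 ^+ 2 - a ^+ 2
    - (v + w.1 + w.2 - a) ^+ 2)); congr (derive1 _ b); apply/funext => x.
  by rewrite /Omega /v5_of /= !real_normK ?num_real//; ring.
rewrite D1 D2 /=.
rewrite (_ : _ + _ = (2 * s) ^+ 2 *
  ((2 * q.1 + q.2) ^+ 2 + (q.1 + 2 * q.2) ^+ 2)); last by field.
by rewrite sqrtrM ?sqr_ge0// sqrtr_sqr ger0_norm// mulr_ge0.
Qed.

(** Every point is reached by the homothety of ratio 1, which turns the previous formula into one
    valid on the whole plane. *)
Lemma grad_norm_OmegaE v w p : grad_norm (Omega v w) p =
  2 * ellipse_slope (p.1 - (Omega_center v w).1, p.2 - (Omega_center v w).2).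
Proof.
rewrite -[2]mulr1 -(grad_norm_Omega v w)//; congr grad_norm.
by rewrite [LHS]surjective_pairing; congr (_, _); rewrite /=; ring.
Qed.

Lemma measurable_ellipse_slope : measurable_fun setT ellipse_slope.
Proof.
apply: measurableT_comp; first exact: (continuous_measurable_fun (@sqrt_continuous R)).
by apply: measurable_funD; apply: measurable_funX; apply: measurable_funD => //;
  apply: measurable_funM.
Qed.

Lemma measurable_grad_norm_Omega v w : measurable_fun setT (grad_norm (Omega v w)).
Proof.
rewrite (funext (grad_norm_OmegaE v w)).
apply: measurable_funM => //; apply: (measurableT_comp measurable_ellipse_slope).
by apply: measurable_fun_pair; apply: measurable_funB.
Qed.

Lemma measurable_Omega v w : measurable_fun setT (Omega v w).
Proof.
have -> : Omega v w = fun p => `|v| ^+ 2 + `|w.1| ^+ 2 + `|w.2| ^+ 2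
    - p.1 ^+ 2 - p.2 ^+ 2 - (v + w.1 + w.2 - p.1 - p.2) ^+ 2.
  by apply/funext => p; rewrite /Omega /v5_of !(@real_normK _ p.1, @real_normK _ p.2,
    @real_normK _ (_ - p.2)) ?num_real.
by repeat (apply: measurable_funB || apply: measurable_funX) => //.
Qed.

(** [hausdorff1] on the plane is not sigma-finite; its restriction to the ellipse is finite, which
    gives access to Tonelli's theorem. *)
Definition ellipse_measure : {finite_measure set (R * R)%type -> \bar R} :=
  mfrestr (@measurable_ellipse R) hausdorff1_ellipse_lty.

(* The radius cancels unless it vanishes, and then the quotient is [0], which is
   also the integral over the one-point zero set of [Omega v w]. *)
Definition resonant_weight v w q : R :=
  Omega_radius v w * \1_ellipse q / (2 * Omega_radius v w * ellipse_slope q).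

(** Change of variables: by scaling, [hausdorff1] is [r] times its own pushforward under the
    homothety, and the zero set pulls back to the ellipse. *)
Let ge0_delta_integral_Omega v w F : measurable_fun setT F -> (forall p, 0 <= F p) ->
  0 < Omega_radius v w ->
  (\int[hausdorff1]_(p in [set p | Omega v w p = 0%R]) (F p)%:E =
   \int[ellipse_measure]_q
     (F (resonant_pair v w q) * (Omega_radius v w * \1_ellipse q))%:E)%E.
Proof.
set r := Omega_radius v w => mF F0 r0.
have r0' : 0 <= r by exact: ltW.
pose T := homothety (Omega_center v w) r.
have mT : measurable_fun setT T.
  by apply: measurable_fun_pair; apply: measurable_funD => //; apply: measurable_funM.
pose H : {measure set (R * R)%type -> \bar R} := hausdorff1.
have preim : T @^-1` [set p | Omega v w p = 0] = ellipse.
  apply/seteqP; split => q /=; rewrite Omega_homothety -/r /ellipse/=.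
    move=> h; apply: (@mulfI _ (2 * r ^+ 2)); first by rewrite mulf_neq0// expf_neq0// gt_eqF.
    by move: h; lra.
  by move=> ->; ring.
have mD : measurable [set p | Omega v w p = 0].
  rewrite -[X in measurable X]setTI.
  exact: (measurable_Omega v w measurableT (measurable_set1 0)).
have mFE D : measurable_fun D (EFin \o F).
  by apply: measurable_funTS; exact/measurable_EFinP.
have F0' p : (0 <= (EFin \o F) p)%E by rewrite lee_fin.
have pushE : (\int[pushforward H T]_(p in [set p | Omega v w p = 0%R]) (F p)%:E =
    \int[hausdorff1]_(q in ellipse) (F (T q))%:E)%E.
  rewrite (@ge0_integral_pushforward _ _ _ _ _ T mT H _ (EFin \o F)) ?preim//.
have scaleE : (\int[hausdorff1]_(p in [set p | Omega v w p = 0%R]) (F p)%:E =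
    r%:E * \int[pushforward H T]_(p in [set p | Omega v w p = 0%R]) (F p)%:E)%E.
  pose HT : {measure set (R * R)%type -> \bar R} := pushforward H T.
  rewrite (@eq_measure_integral _ _ _ _ (mscale (NngNum r0') (HT mT))); last first.
    by move=> A _ _; exact: (esym (@hausdorff1_homothety _ (Omega_center v w) r A r0)).
  rewrite ge0_integral_mscale//=.
  by move=> p _; exact: F0'.
have mE := @measurable_ellipse R.
have mFT : measurable_fun ellipse (fun q => (F (T q))%:E).
  by apply: measurable_funTS; exact: (measurableT_comp (mFE setT) mT).
rewrite scaleE pushE -(@ge0_integralZl_EFin _ _ _ H ellipse mE (fun q => (F (T q))%:E)
  (fun q _ => F0' (T q)) mFT r r0').
(* The two measures agree on subsets of the ellipse; the indicator then extends the integral to the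
   whole plane. *)
rewrite (@eq_measure_integral _ _ _ _ ellipse_measure); last first.
  move=> A mA AE; rewrite /ellipse_measure/= /mfrestr /mrestr/=.
  by congr hausdorff1; apply/esym/setIidPl.
rewrite integral_mkcond; apply: eq_integral => q _.
rewrite patchE indicE; case: ifPn => _; last by rewrite !mulr0.
by rewrite mulr1 -EFinM mulrC.
Qed.

Lemma delta_integral_Omega v w F : measurable_fun setT F ->
  (delta_integral (Omega v w) F = \int[ellipse_measure]_q
     (F (resonant_pair v w q) * resonant_weight v w q)%:E)%E.
Proof.
move=> mF.
have [r0|r0] := eqVneq (Omega_radius v w) 0.
  rewrite [RHS]integral0_eq; last first.
    by move=> q _; rewrite /resonant_weight r0 !mul0r mulr0.
  rewrite /delta_integral integral0_eq// => p /= Op.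
  pose q := (p.1 - (Omega_center v w).1, p.2 - (Omega_center v w).2).
  have pE : p = homothety (Omega_center v w) 1 q.
    by rewrite [LHS]surjective_pairing; congr (_, _); rewrite /=; ring.
  (* The form is positive definite, so a vanishing radius leaves only the centre, where the gradient
     vanishes and division by 0 gives 0. *)
  move: Op; rewrite pE Omega_homothety r0 grad_norm_Omega//.
  rewrite /ellipse_form /ellipse_slope; case: (q) => a b /= ab.
  have a0 : a = 0.
    by apply/eqP; rewrite -sqrf_eq0; apply/eqP; have := sqr_ge0 (a / 2 + b);
       have := sqr_ge0 a; lra.
  have b0 : b = 0.
    by apply/eqP; rewrite -sqrf_eq0; apply/eqP; rewrite a0 in ab; lra.
  by rewrite a0 b0 !mulr0 addr0 expr0n/= addr0 sqrtr0 mulr0 invr0 mulr0.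
have {r0} : 0 < Omega_radius v w by rewrite lt_neqAle eq_sym r0 sqrtr_ge0.
move=> r0.
pose G p := F p / grad_norm (Omega v w) p.
have mG : measurable_fun setT G.
  apply: measurable_funM => //.
  exact: (measurableT_comp measurable_invr (measurable_grad_norm_Omega v w)).
have posE (g : R * R -> R) :
    (fun p => (g p)%:E)^\+%E = fun p => (Num.max (g p) 0)%:E.
  by apply/funext => p; rewrite funeposE EFin_max.
have negE (g : R * R -> R) :
    (fun p => (g p)%:E)^\-%E = fun p => (Num.max (- g p) 0)%:E.
  by apply/funext => p; rewrite funenegE EFin_max.
have weightE q : F (resonant_pair v w q) * resonant_weight v w q =
    G (resonant_pair v w q) * (Omega_radius v w * \1_ellipse q).
  rewrite /G grad_norm_Omega ?ltW// /resonant_weight.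
  by ring.
(* The nonnegative case is applied to the positive and negative parts of [G]. *)
rewrite /delta_integral integralE [RHS]integralE !posE !negE.
have max0 (g : R * R -> R) p : 0 <= Num.max (g p) 0 by rewrite le_max lexx orbT.
have mmax (g : R * R -> R) : measurable_fun setT g ->
    measurable_fun setT (fun p => Num.max (g p) 0).
  by move=> mg; exact: measurable_maxr.
have mGN : measurable_fun setT (fun p => - G p) by exact: measurable_funN.
rewrite (ge0_delta_integral_Omega (mmax _ mG)) ?(ge0_delta_integral_Omega (mmax _ mGN))//;
  last exact: (max0 (fun p => - G p)).
congr (_ - _)%E; apply: eq_integral => q _; congr EFin; rewrite weightE.
  by rewrite maxr_pMl ?mulr_ge0 ?(ltW r0)// mul0r.
by rewrite maxr_pMl ?mulr_ge0 ?(ltW r0)// mul0r mulNr.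
Qed.

Lemma resonant_pairP v w q : q \in ellipse ->
  Omega v w (resonant_pair v w q) = 0.
Proof. by rewrite inE /ellipse /= => qE; rewrite Omega_homothety qE; ring. Qed.

Lemma resonant_weight_notin v w q : q \notin ellipse -> resonant_weight v w q = 0.
Proof. by rewrite /resonant_weight indicE => /negbTE ->; rewrite mulr0 mul0r. Qed.

Lemma resonant_weight_ge0 v w q : 0 <= resonant_weight v w q.
Proof. by rewrite divr_ge0 ?mulr_ge0 ?sqrtr_ge0// indicE. Qed.

Lemma resonant_weight_le1 v w q : resonant_weight v w q <= 1.
Proof.
have [qE|/resonant_weight_notin ->//] := boolP (q \in ellipse).
rewrite /resonant_weight indicE qE mulr1.
have [->|r0] := eqVneq (Omega_radius v w) 0; first by rewrite mul0r.
have r_gt0 : 0 < Omega_radius v w by rewrite lt_neqAle eq_sym r0 sqrtr_ge0.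
(* On the ellipse the squared slope equals [6 + 3 * (q.1 + q.2) ^+ 2]. *)
have slope1 : 1 <= ellipse_slope q.
  rewrite -[leLHS]sqrtr1 ler_wsqrtr//.
  move: qE; rewrite inE /ellipse /ellipse_form/= => qE.
  have := sqr_ge0 (q.1 + q.2); lra.
have d_gt0 : 0 < 2 * Omega_radius v w * ellipse_slope q.
  by rewrite !mulr_gt0// (lt_le_trans ltr01).
rewrite ler_pdivrMr// mul1r; nra.
Qed.

Lemma measurable_Omega_radius : measurable_fun setT
  (fun z : R * (R * R) => Omega_radius z.1 z.2).
Proof.
apply: measurableT_comp; first exact: (continuous_measurable_fun (@sqrt_continuous R)).
apply: measurable_funM => //.
have m1 : measurable_fun setT (fun z : R * (R * R) => z.2.1) by exact: measurableT_comp.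
have m2 : measurable_fun setT (fun z : R * (R * R) => z.2.2) by exact: measurableT_comp.
by repeat (apply: measurable_funB || apply: measurable_funD || apply: measurable_funM
  || apply: measurable_funX).
Qed.

Lemma measurable_resonant_pair : measurable_fun setT
  (fun z : R * (R * R) * (R * R) => resonant_pair z.1.1 z.1.2 z.2).
Proof.
have mr : measurable_fun setT (fun z : R * (R * R) * (R * R) => Omega_radius z.1.1 z.1.2).
  exact: (measurableT_comp measurable_Omega_radius measurable_fst).
have m1 : measurable_fun setT (fun z : R * (R * R) * (R * R) => z.1.2.1).
  by do 2 apply: measurableT_comp => //.
have m2 : measurable_fun setT (fun z : R * (R * R) * (R * R) => z.1.2.2).
  by do 2 apply: measurableT_comp => //.
have m0 : measurable_fun setT (fun z : R * (R * R) * (R * R) => z.1.1).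
  by apply: measurableT_comp.
have mc : measurable_fun setT (fun z : R * (R * R) * (R * R) =>
    (z.1.1 + z.1.2.1 + z.1.2.2) / 3).
  by apply: measurable_funM => //; do 2 apply: measurable_funD => //.
by apply: measurable_fun_pair; apply: measurable_funD => //; apply: measurable_funM => //;
  exact: measurableT_comp.
Qed.

Lemma measurable_resonant_weight : measurable_fun setT
  (fun z : R * (R * R) * (R * R) => resonant_weight z.1.1 z.1.2 z.2).
Proof.
have mr : measurable_fun setT (fun z : R * (R * R) * (R * R) => Omega_radius z.1.1 z.1.2).
  exact: (measurableT_comp measurable_Omega_radius measurable_fst).
apply: measurable_funM.
  apply: measurable_funM => //.
  have mi : measurable_fun setT (\1_ellipse : R * R -> R).
    by apply: measurable_indic; exact: measurable_ellipse.
  exact: (measurableT_comp mi measurable_snd).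
apply: (measurableT_comp measurable_invr); apply: measurable_funM.
  exact: measurable_funM.
exact: (measurableT_comp measurable_ellipse_slope measurable_snd).
Qed.

End resonant_ellipse.

(** * The collision operator *)

Section dominated_pairs.
Context {R : realType}.
Implicit Types (K d e a b : R).

(* Propagating the two amplitudes together with their difference gives
   boundedness and Lipschitz continuity of the collision operator at once. *)
Definition dominated_pair K d e a b : Prop :=
  [/\ `|a| <= K * e, `|b| <= K * e & `|a - b| <= d * e].

(** A discrete product rule: the two factors are changed one at a time. *)
Lemma dominated_pairM K d e a b K' d' e' a' b' :
  dominated_pair K d e a b -> dominated_pair K' d' e' a' b' ->
  dominated_pair (K * K') (K * d' + K' * d) (e * e') (a * a') (b * b').
Proof.
move=> [aK bK abd] [aK' bK' abd'].
split.
- by rewrite normrM mulrACA; apply: ler_pM.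
- by rewrite normrM mulrACA; apply: ler_pM.
rewrite (_ : a * a' - b * b' = a * (a' - b') + (a - b) * b'); last by ring.
apply: le_trans (ler_normD _ _) _; rewrite !normrM mulrDl.
rewrite [K * d' * _]mulrACA [K' * d]mulrC [d * K' * _]mulrACA.
by apply: lerD; apply: ler_pM.
Qed.

Lemma dominated_pairD K d e a b K' d' a' b' :
  dominated_pair K d e a b -> dominated_pair K' d' e a' b' ->
  dominated_pair (K + K') (d + d') e (a + a') (b + b').
Proof.
move=> [aK bK abd] [aK' bK' abd']; rewrite /dominated_pair !mulrDl.
split; try by apply: le_trans (ler_normD _ _) _; exact: lerD.
by rewrite opprD addrACA (le_trans (ler_normD _ _))// lerD.
Qed.

Lemma dominated_pairN K d e a b :
  dominated_pair K d e a b -> dominated_pair K d e (- a) (- b).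
Proof. by move=> [aK bK abd]; split; rewrite ?normrN// -opprD normrN. Qed.

Lemma dominated_pairW K d e e' a b : 0 <= K -> 0 <= d -> e <= e' ->
  dominated_pair K d e a b -> dominated_pair K d e' a b.
Proof.
by move=> K0 d0 ee' [aK bK abd]; split;
  [apply: le_trans aK _|apply: le_trans bK _|apply: le_trans abd _]; rewrite ler_wpM2l.
Qed.

(** The functions [a], [b] and [a - b] are each dominated by a multiple of the integrable [e], which
    yields integrability along with the bounds. *)
Lemma dominated_pair_integral dT (T : measurableType dT)
    (mu : {measure set T -> \bar R}) (D : set T) K d (e a b : T -> R) :
  measurable D -> measurable_fun D a -> measurable_fun D b ->
  mu.-integrable D (EFin \o e) ->
  (forall x, D x -> dominated_pair K d (e x) (a x) (b x)) ->
  [/\ mu.-integrable D (EFin \o a), mu.-integrable D (EFin \o b) &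
     dominated_pair K d (\int[mu]_(x in D) e x)%R
       (\int[mu]_(x in D) a x)%R (\int[mu]_(x in D) b x)%R].
Proof.
move=> mD ma mb ie ab.
have iMe k : mu.-integrable D (EFin \o (fun x => k * e x)).
  rewrite (_ : EFin \o _ = (fun x => k%:E * (EFin \o e) x)%E) //.
  exact: integrableZl.
have ge_int (f : T -> R) k : measurable_fun D f ->
    (forall x, D x -> `|f x| <= k * e x) -> mu.-integrable D (EFin \o f) /\
    `|(\int[mu]_(x in D) f x)%R| <= k * (\int[mu]_(x in D) e x)%R.
  move=> mf fe.
  have intf : mu.-integrable D (EFin \o f).
    apply: le_integrable (iMe k) => //; first exact/measurable_EFinP.
    move=> x Dx; rewrite /= lee_fin (le_trans (fe x Dx))//; exact: ler_norm.
  split=> //; apply: le_trans (le_normr_Rintegral _ _) _ => //.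
  rewrite -RintegralZl//; apply: le_Rintegral => //.
  exact: integrable_norm.
have [ia aE] := ge_int a K ma (fun x Dx => let: And3 h _ _ := ab x Dx in h).
have [ib bE] := ge_int b K mb (fun x Dx => let: And3 _ h _ := ab x Dx in h).
have [_ abE] := ge_int (fun x => a x - b x) d (measurable_funB ma mb)
  (fun x Dx => let: And3 _ _ h := ab x Dx in h).
by split=> //; split=> //; rewrite -RintegralB.
Qed.

End dominated_pairs.

(** Tonelli's theorem gives measurability for the positive and negative parts separately. *)
Lemma measurable_integral_param d1 d2 (T1 : measurableType d1) (T2 : measurableType d2)
    (R : realType) (mu : {sigma_finite_measure set T2 -> \bar R})
    (f : T1 * T2 -> \bar R) :
  measurable_fun setT f -> measurable_fun setT (fun x => \int[mu]_y f (x, y))%E.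
Proof.
move=> mf.
rewrite (_ : (fun x => _) = (fun x => \int[mu]_y f^\+ (x, y) - \int[mu]_y f^\- (x, y))%E).
  apply: emeasurable_funB.
    by apply: (measurable_fun_fubini_tonelli_F (m2 := mu) f^\+%E) => //; exact: measurable_funepos.
  by apply: (measurable_fun_fubini_tonelli_F (m2 := mu) f^\-%E) => //; exact: measurable_funeneg.
apply/funext => x; rewrite integralE; congr (_ - _)%E.
  by apply: eq_integral => y _; rewrite !funeposE.
by apply: eq_integral => y _; rewrite !funenegE.
Qed.

(** * Pointwise bounds on the collision integrand and Gaussian integrals *)

Section collision_estimate.
Context {R : realType}.
Variables (alpha beta : R).
Hypotheses (alpha0 : 0 < alpha) (beta0 : 0 < beta).
Implicit Types (s t x y u v : R) (w q : R * R) (f g : R -> R -> R -> R).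

(* The weight of [norm_ab] carried by free transport to time [s]. *)
Definition flow_weight s y u : R :=
  expR (- (alpha * (y - s * u) ^+ 2 + beta * u ^+ 2)).

Lemma flow_weight_gt0 s y u : 0 < flow_weight s y u.
Proof. exact: expR_gt0. Qed.

Lemma flow_weight_le1 s y u : flow_weight s y u <= 1.
Proof.
by rewrite -expR0 ler_expR oppr_le0 addr_ge0// mulr_ge0 ?sqr_ge0// ltW.
Qed.

(* The exponents are combinations of the sums of the velocities and of their
   squares, which agree on both sides. *)
Lemma flow_weight_resonant s y v w q : Omega v w q = 0 ->
  flow_weight s y q.1 * flow_weight s y q.2 * flow_weight s y (v5_of v w q) =
  flow_weight s y v * flow_weight s y w.1 * flow_weight s y w.2.
Proof.
move=> O0; rewrite -!expRD; congr expR; apply/eqP; rewrite -subr_eq0; apply/eqP.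
transitivity ((alpha * s ^+ 2 + beta) * Omega v w q); last by rewrite O0 mulr0.
by rewrite /Omega !real_normK ?num_real// /v5_of; ring.
Qed.

(** Each of the six quintic monomials contains all of [f3 f4 f5] or all of [f0 f1 f2], and by
    resonance both triples carry the weight [e]. *)
Lemma collision_dominated M D f g s y v w q : 0 <= M -> 0 <= D ->
  (forall u, dominated_pair M D (flow_weight s y u) (f s y u) (g s y u)) ->
  Omega v w q = 0 ->
  dominated_pair (6 * M ^+ 5) (30 * M ^+ 4 * D)
    (flow_weight s y v * flow_weight s y w.1 * flow_weight s y w.2)
    (collision_integrand f s y v w q) (collision_integrand g s y v w q).
Proof.
move=> M0 D0 fg O0; set e := _ * flow_weight s y w.2.
have K0 : 0 <= M ^+ 5 by exact: exprn_ge0.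
have d0 : 0 <= 5 * M ^+ 4 * D by rewrite !mulr_ge0// exprn_ge0.
(* The weights at [a], [b], [c] multiply to [e] and the other two are at most 1; the factor 5 counts
   the factors in which the difference may fall. *)
have quint a b c a' b' : flow_weight s y a * flow_weight s y b * flow_weight s y c = e ->
    dominated_pair (M ^+ 5) (5 * M ^+ 4 * D) e
    (f s y a * f s y b * f s y c * f s y a' * f s y b')
    (g s y a * g s y b * g s y c * g s y a' * g s y b').
  move=> abc.
  have := dominated_pairM (dominated_pairM (dominated_pairM
    (dominated_pairM (fg a) (fg b)) (fg c)) (fg a')) (fg b').
  rewrite abc (_ : _ * M = M ^+ 5); last by ring.
  rewrite (_ : _ + _ = 5 * M ^+ 4 * D); last by ring.
  apply: dominated_pairW => //; rewrite -mulrA ler_piMr//.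
    by rewrite /e !mulr_ge0// ltW// flow_weight_gt0.
  by rewrite mulr_ile1// ?flow_weight_le1// ltW// flow_weight_gt0.
have r345 := flow_weight_resonant s y O0.
have -> : 6 * M ^+ 5 = M ^+ 5 + M ^+ 5 + M ^+ 5 + M ^+ 5 + M ^+ 5 + M ^+ 5 by ring.
have -> : 30 * M ^+ 4 * D = 5 * M ^+ 4 * D + 5 * M ^+ 4 * D + 5 * M ^+ 4 * D
  + 5 * M ^+ 4 * D + 5 * M ^+ 4 * D + 5 * M ^+ 4 * D by ring.
pose five (h : R -> R -> R -> R) a b c a' b' : R :=
  h s y a * h s y b * h s y c * h s y a' * h s y b'.
have collE h : collision_integrand h s y v w q =
    five h q.1 q.2 (v5_of v w q) v w.1 + five h q.1 q.2 (v5_of v w q) v w.2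
  + five h q.1 q.2 (v5_of v w q) w.1 w.2 + - five h v w.1 w.2 q.1 q.2
  + - five h v w.1 w.2 q.1 (v5_of v w q) + - five h v w.1 w.2 q.2 (v5_of v w q).
  by rewrite /collision_integrand /five; ring.
rewrite !collE; do 5 (apply: dominated_pairD; last first; first
  by try apply: dominated_pairN; exact: quint).
exact: quint.
Qed.

(** Off the ellipse the weight vanishes; on it the pair is resonant and the weight is at most 1. *)
Lemma weighted_collision_dominated M D f g s y v w q : 0 <= M -> 0 <= D ->
  (forall u, dominated_pair M D (flow_weight s y u) (f s y u) (g s y u)) ->
  dominated_pair (6 * M ^+ 5) (30 * M ^+ 4 * D)
    (flow_weight s y v * flow_weight s y w.1 * flow_weight s y w.2)
    (collision_integrand f s y v w (resonant_pair v w q) * resonant_weight v w q)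
    (collision_integrand g s y v w (resonant_pair v w q) * resonant_weight v w q).
Proof.
move=> M0 D0 fg; set e := _ * flow_weight s y w.2.
have [qE|qE] := boolP (q \in ellipse); last first.
  rewrite !resonant_weight_notin// !mulr0.
  by split; rewrite ?subrr normr0 !mulr_ge0// ?exprn_ge0// ltW ?flow_weight_gt0.
have [fe ge fge] := collision_dominated M0 D0 fg (resonant_pairP v w qE).
have W0 := resonant_weight_ge0 v w q; have W1 := resonant_weight_le1 v w q.
have le a b : `|a| <= b -> `|a * resonant_weight v w q| <= b.
  by move=> ab; rewrite normrM (ger0_norm W0) (le_trans _ ab)// ler_piMr.
by split; rewrite -?mulrBl; exact: le.
Qed.

(* Completing the square in [u]. *)
Definition gauss_weight s y u : R :=
  expR (- ((alpha * s ^+ 2 + beta) * (u - alpha * s * y / (alpha * s ^+ 2 + beta)) ^+ 2)).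

Lemma measurable_gauss_weight s y : measurable_fun setT (gauss_weight s y).
Proof.
apply: measurableT_comp => //; apply: measurable_funN.
by apply: measurable_funM => //; apply: measurable_funX => //; apply: measurable_funB.
Qed.

Lemma denom_gt0 s : 0 < alpha * s ^+ 2 + beta.
Proof. by rewrite ltr_wpDl// mulr_ge0 ?sqr_ge0// ltW. Qed.

(** Completing the square leaves a nonnegative remainder proportional to [y ^+ 2]; dropping it makes
    the integral in [u] independent of [y]. *)
Lemma flow_weight_le_gauss s y u : flow_weight s y u <= gauss_weight s y u.
Proof.
have l0 := denom_gt0 s; rewrite ler_expR lerN2 -subr_ge0.
rewrite (_ : _ - _ = alpha * beta * y ^+ 2 / (alpha * s ^+ 2 + beta)).
  by rewrite divr_ge0 ?(ltW l0)// mulr_ge0 ?sqr_ge0// mulr_ge0 ?(ltW alpha0) ?(ltW beta0).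
by field; rewrite gt_eqF.
Qed.

(** Up to its peak value, [gauss_weight s y] is a normal density of variance [(2 * l)^-1]. *)
Lemma gauss_weight_integral s y :
  (\int[lebesgue_measure]_u (gauss_weight s y u)%:E =
   (Num.sqrt (pi / (alpha * s ^+ 2 + beta)))%:E)%E.
Proof.
have l0 := denom_gt0 s; set l := alpha * s ^+ 2 + beta in l0 *.
pose m := alpha * s * y / l; pose sigma := Num.sqrt ((2 * l)^-1).
have sigma0 : 0 < sigma by rewrite sqrtr_gt0 invr_gt0 mulr_gt0.
have sigma2 : sigma ^+ 2 = (2 * l)^-1 by rewrite sqr_sqrtr// invr_ge0 mulr_ge0// ltW.
have peak0 : 0 < normal_peak sigma by rewrite normal_peak_gt0// gt_eqF.
have := @integral_normal_pdf R m sigma.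
under eq_integral => u _.
  rewrite normal_pdfE ?gt_eqF// (_ : normal_fun m sigma u = gauss_weight s y u); last first.
    rewrite /normal_fun /gauss_weight -/l -/m; congr expR.
    by rewrite sigma2; field; rewrite gt_eqF.
  rewrite EFinM; over.
rewrite ge0_integralZl_EFin ?(ltW peak0)//.
- move/(congr1 (fun z => (normal_peak sigma)^-1%:E * z)%E).
  rewrite muleA -EFinM mulVf ?gt_eqF// mul1e mule1 => ->.
  rewrite /normal_peak invrK; congr (EFin (Num.sqrt _)).
  by rewrite sigma2 -mulr_natr; field; rewrite gt_eqF.
- by move=> u _; rewrite lee_fin expR_ge0.
- by apply/measurable_EFinP; exact: measurable_gauss_weight.
Qed.

End collision_estimate.

(* The library's instance of sigma-finiteness for products is shadowed by the
   one for pairs of subprobabilities, hence the explicit packing. *)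
Definition lebesgue_measure2 {R : realType} :
    {sigma_finite_measure set (measurableTypeR R * measurableTypeR R)%type -> \bar R} :=
  HB.pack (product_measure1 (@lebesgue_measure R) (@lebesgue_measure R))
    (lebesgue_integral_fubini.measure_function_Measure_isSigmaFinite__to__measure_function_isSFinite
       (@lebesgue_measure R) (@lebesgue_measure R))
    (lebesgue_integral_fubini.measure_function_Measure_isSigmaFinite__to__measure_function_isSigmaFinite
       (@lebesgue_measure R) (@lebesgue_measure R)).

(** * Measurability and domination of the collision operator *)

Section collision_operator.
Context {R : realType}.
Variables (alpha beta : R).
Hypotheses (alpha0 : 0 < alpha) (beta0 : 0 < beta).
Implicit Types (s t x y u v : R) (w q : R * R) (f g : R -> R -> R -> R).

Local Notation leb := (@lebesgue_measure R).
Local Notation mu := (@ellipse_measure R).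
Local Notation weight := (flow_weight alpha beta).
Local Notation gauss := (gauss_weight alpha beta).

Definition resonant_integrand f s y v w q : R :=
  collision_integrand f s y v w (resonant_pair v w q) * resonant_weight v w q.

Definition resonant_integral f s y v w : R :=
  (\int[mu]_q resonant_integrand f s y v w q)%R.

(** Real-valued counterpart of [C6]. [Rintegral] sends infinite values to 0; the two agree for
    dominated arguments, by [C6_dominated]. *)
Definition collision f s y v : R :=
  (\int[(leb \x leb)%E]_w resonant_integral f s y v w)%R.

Lemma measurable_collision_integrand f : jointly_measurable f ->
  measurable_fun setT (fun z : R * R * R * (R * R) * (R * R) =>
    collision_integrand f z.1.1.1.1 z.1.1.1.2 z.1.1.2 z.1.2 z.2).
Proof.
move=> mf.
have mfu (u : R * R * R * (R * R) * (R * R) -> R) : measurable_fun setT u ->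
    measurable_fun setT (fun z => f z.1.1.1.1 z.1.1.1.2 (u z)).
  move=> m_u; have mz : measurable_fun setT
      (fun z : R * R * R * (R * R) * (R * R) => (z.1.1.1, u z)).
    by apply: measurable_fun_pair => //; do 2 apply: measurableT_comp => //.
  exact: (measurableT_comp mf mz).
have mv : measurable_fun setT (fun z : R * R * R * (R * R) * (R * R) => z.1.1.2).
  by do 2 apply: measurableT_comp => //.
have mw1 : measurable_fun setT (fun z : R * R * R * (R * R) * (R * R) => z.1.2.1).
  by do 2 apply: measurableT_comp => //.
have mw2 : measurable_fun setT (fun z : R * R * R * (R * R) * (R * R) => z.1.2.2).
  by do 2 apply: measurableT_comp => //.
have mq1 : measurable_fun setT (fun z : R * R * R * (R * R) * (R * R) => z.2.1).
  by apply: measurableT_comp.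
have mq2 : measurable_fun setT (fun z : R * R * R * (R * R) * (R * R) => z.2.2).
  by apply: measurableT_comp.
have m5 : measurable_fun setT (fun z : R * R * R * (R * R) * (R * R) =>
    v5_of z.1.1.2 z.1.2 z.2).
  by do 2 (apply: measurable_funB => //); do 2 (apply: measurable_funD => //).
move: (mfu _ mv) (mfu _ mw1) (mfu _ mw2) (mfu _ mq1) (mfu _ mq2) (mfu _ m5).
move=> m0' m1' m2' m3' m4' m5'.
by apply: measurable_funB; repeat (apply: measurable_funM || apply: measurable_funD).
Qed.

Lemma measurable_resonant_integrand f : jointly_measurable f ->
  measurable_fun setT (fun z : R * R * R * (R * R) * (R * R) =>
    resonant_integrand f z.1.1.1.1 z.1.1.1.2 z.1.1.2 z.1.2 z.2).
Proof.
move=> mf.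
have mz : measurable_fun setT (fun z : R * R * R * (R * R) * (R * R) =>
    (z.1.1.2, z.1.2, z.2)).
  by repeat apply: measurable_fun_pair => //; do 2 apply: measurableT_comp => //.
apply: measurable_funM; last exact: (measurableT_comp measurable_resonant_weight mz).
have mz' : measurable_fun setT (fun z : R * R * R * (R * R) * (R * R) =>
    (z.1, resonant_pair z.1.1.2 z.1.2 z.2)).
  apply: measurable_fun_pair => //.
  exact: (measurableT_comp measurable_resonant_pair mz).
exact: (measurableT_comp (measurable_collision_integrand mf) mz').
Qed.

Lemma measurable_resonant_integral f : jointly_measurable f ->
  measurable_fun setT (fun z : R * R * R * (R * R) =>
    resonant_integral f z.1.1.1 z.1.1.2 z.1.2 z.2).
Proof.
move=> mf; apply: (measurableT_comp (@fine_measurable R setT measurableT)).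
apply: (measurable_integral_param mu (f := fun z : R * R * R * (R * R) * (R * R) =>
  (resonant_integrand f z.1.1.1.1 z.1.1.1.2 z.1.1.2 z.1.2 z.2)%:E)).
by apply/measurable_EFinP; exact: measurable_resonant_integrand.
Qed.

Lemma measurable_collision f : jointly_measurable f ->
  jointly_measurable (collision f).
Proof.
move=> mf; apply: (measurableT_comp (@fine_measurable R setT measurableT)).
apply: (measurable_integral_param lebesgue_measure2 (f := fun z : R * R * R * (R * R) =>
  (resonant_integral f z.1.1.1 z.1.1.2 z.1.2 z.2)%:E)).
by apply/measurable_EFinP; exact: measurable_resonant_integral.
Qed.

(** The length of the ellipse times the numerator of the Gaussian integral in [v1], [v2]. *)
Definition collision_constant : R := fine (mu setT) * pi.

Lemma collision_constant_ge0 : 0 <= collision_constant.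
Proof. by rewrite mulr_ge0 ?pi_ge0// fine_ge0. Qed.

Lemma gauss_weight2_integral s y :
  (\int[leb \x leb]_w (gauss s y w.1 * gauss s y w.2)%:E =
   (pi / (alpha * s ^+ 2 + beta))%:E)%E.
Proof.
have l0 := denom_gt0 alpha0 beta0 s.
have mg := measurable_gauss_weight alpha beta s y.
transitivity (\int[leb]_a \int[leb]_b (gauss s y a * gauss s y b)%:E)%E.
  apply: (fubini_tonelli1 (m1 := leb) (m2 := leb)
    (fun w : measurableTypeR R * measurableTypeR R =>
      (gauss s y w.1 * gauss s y w.2)%:E)).
    apply/measurable_EFinP; apply: measurable_funM.
      exact: (measurableT_comp mg measurable_fst).
    exact: (measurableT_comp mg measurable_snd).
  by move=> w; rewrite lee_fin mulr_ge0 ?expR_ge0.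
have mge : measurable_fun setT (fun u => (gauss s y u)%:E) by exact/measurable_EFinP.
have ge0 u : (0 <= (gauss s y u)%:E)%E by rewrite lee_fin expR_ge0.
under eq_integral => a _.
  under eq_integral do rewrite EFinM.
  rewrite ge0_integralZl_EFin ?expR_ge0// gauss_weight_integral// muleC; over.
rewrite ge0_integralZl_EFin ?sqrtr_ge0// gauss_weight_integral// -EFinM -expr2.
by rewrite sqr_sqrtr// divr_ge0 ?pi_ge0// ltW.
Qed.

Lemma gauss_weight2_integrable s y : (leb \x leb)%E.-integrable setT
  (fun w => (gauss s y w.1 * gauss s y w.2)%:E).
Proof.
have mg := measurable_gauss_weight alpha beta s y.
apply/integrableP; split.
  apply/measurable_EFinP; apply: measurable_funM.
    exact: (measurableT_comp mg measurable_fst).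
  exact: (measurableT_comp mg measurable_snd).
under eq_integral do rewrite gee0_abs ?lee_fin ?mulr_ge0 ?expR_ge0//.
by rewrite gauss_weight2_integral ltry.
Qed.

(** The pointwise domination is integrated first over the ellipse, then over [v1], [v2]. *)
Lemma C6_dominated M D f g s y v : 0 <= M -> 0 <= D ->
  jointly_measurable f -> jointly_measurable g ->
  (forall u, dominated_pair M D (weight s y u) (f s y u) (g s y u)) ->
  [/\ C6 f s y v = (collision f s y v)%:E, C6 g s y v = (collision g s y v)%:E &
  dominated_pair (6 * M ^+ 5) (30 * M ^+ 4 * D)
    (collision_constant * weight s y v / (alpha * s ^+ 2 + beta))
    (collision f s y v) (collision g s y v)].
Proof.
move=> M0 D0 mf mg fg.
have K0 : 0 <= 6 * M ^+ 5 by rewrite mulr_ge0// exprn_ge0.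
have d0 : 0 <= 30 * M ^+ 4 * D by rewrite !mulr_ge0// exprn_ge0.
pose e w := weight s y v * weight s y w.1 * weight s y w.2.
have mKq h w : jointly_measurable h -> measurable_fun setT (resonant_integrand h s y v w).
  move=> mh; apply: (measurableT_comp (measurable_resonant_integrand mh)
    (g := fun q => (s, y, v, w, q))).
  by apply: measurable_fun_pair.
have inner w := @dominated_pair_integral R _ _ mu setT _ _ (cst (e w)) _ _ measurableT
  (mKq f w mf) (mKq g w mg) (finite_measure_integrable_cst mu (e w) measurableT)
  (fun q _ => weighted_collision_dominated alpha0 beta0 v w q M0 D0 fg).
(* The bound [e w] is constant on the ellipse, which thus contributes its length; the weights of
   [v1], [v2] are then replaced by Gaussians. *)
pose e' w := fine (mu setT) * weight s y v * (gauss s y w.1 * gauss s y w.2).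
have outer_dom w : dominated_pair (6 * M ^+ 5) (30 * M ^+ 4 * D) (e' w)
    (resonant_integral f s y v w) (resonant_integral g s y v w).
  have [_ _] := inner w; rewrite Rintegral_cst//.
  apply: dominated_pairW => //.
  rewrite /e' /e mulrC -!mulrA ler_wpM2l ?fine_ge0// ler_wpM2l ?expR_ge0//.
  by apply: ler_pM; rewrite ?expR_ge0// flow_weight_le_gauss.
have mIw h : jointly_measurable h -> measurable_fun setT (resonant_integral h s y v).
  move=> mh; apply: (measurableT_comp (measurable_resonant_integral mh)
    (g := fun w => (s, y, v, w))).
  by apply: measurable_fun_pair.
have ie' : (leb \x leb)%E.-integrable setT (EFin \o e').
  rewrite (_ : EFin \o e' = (fun w => (fine (mu setT) * weight s y v)%:E *
    (gauss s y w.1 * gauss s y w.2)%:E)%E)//.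
  by apply: integrableZl => //; exact: gauss_weight2_integrable.
have [iIf iIg] := @dominated_pair_integral R _ _ (leb \x leb)%E setT _ _ e' _ _ measurableT
  (mIw f mf) (mIw g mg) ie' (fun w _ => outer_dom w).
rewrite -/(collision f s y v) -/(collision g s y v).
have -> : (\int[(leb \x leb)%E]_w e' w)%R =
    collision_constant * weight s y v / (alpha * s ^+ 2 + beta).
  rewrite RintegralZl//; last exact: gauss_weight2_integrable.
  by rewrite /Rintegral gauss_weight2_integral /= /collision_constant; ring.
(* Integrability at both levels makes the integrals finite, so that [fine] loses nothing. *)
have C6E h : jointly_measurable h ->
    (forall w, mu.-integrable setT (EFin \o resonant_integrand h s y v w)) ->
    (leb \x leb)%E.-integrable setT (EFin \o resonant_integral h s y v) ->
    C6 h s y v = (collision h s y v)%:E.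
  move=> mh iq iw; rewrite /collision /Rintegral fineK; last first.
    exact: integrable_fin_num.
  apply: eq_integral => w _; rewrite delta_integral_Omega; last first.
    apply: (measurableT_comp (measurable_collision_integrand mh)
      (g := fun q => (s, y, v, w, q))).
    by apply: measurable_fun_pair.
  rewrite /resonant_integral /Rintegral fineK//.
  exact: (integrable_fin_num measurableT (iq w)).
move=> dom; split=> //.
- by apply: C6E => // w; have [] := inner w.
- by apply: C6E => // w; have [] := inner w.
Qed.

End collision_operator.

(** * The Duhamel map *)

Section time_integral.
Context {R : realType}.
Implicit Types (a b h : R -> R) (t : R).

Definition oriented_integral h t : R :=
  if 0 <= t then (\int[lebesgue_measure]_(s in `[0%R, t]) h s)%R
  else (- \int[lebesgue_measure]_(s in `[t, 0%R]) h s)%R.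

(** The variable interval is moved into the integrand as a measurable condition on [(p, s)], leaving
    integrals over a fixed domain. *)
Lemma measurable_oriented_integral d (T : measurableType d) (h : T -> R -> R) (t : T -> R) :
  measurable_fun setT (fun z : T * R => h z.1 z.2) -> measurable_fun setT t ->
  measurable_fun setT (fun p => oriented_integral (h p) (t p)).
Proof.
move=> mh mt.
have mt1 : measurable_fun setT (fun z : T * R => t z.1).
  exact: (measurableT_comp mt measurable_fst).
have restrict (B : T * R -> bool) : measurable_fun setT B -> measurable_fun setT
    (fun p => (\int[lebesgue_measure]_(s in [set s | B (p, s)]) h p s)%R).
  move=> mB; rewrite (_ : (fun p => _) =
      fine \o (fun p => \int[lebesgue_measure]_s
        (if B (p, s) then h p s else 0)%:E)%E).
    apply: (measurableT_comp (@fine_measurable R setT measurableT)).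
    apply: (measurable_integral_param (@lebesgue_measure R)
      (f := fun z : T * R => (if B z then h z.1 z.2 else 0)%:E)).
    by apply/measurable_EFinP; exact: measurable_fun_ifT.
  apply/funext => p; rewrite /= /Rintegral integral_mkcond; congr fine.
  apply: eq_integral => s _; rewrite patchE.
  rewrite (_ : (s \in _) = B (p, s)); first by case: ifP.
  by apply/idP/idP; rewrite inE.
apply: measurable_fun_ifT; first exact: measurable_fun_ler.
  rewrite (_ : (fun p => _) =
    (fun p => (\int[lebesgue_measure]_(s in [set s | (0 <= s) && (s <= t p)]) h p s)%R)).
    apply: (restrict (fun z => (0 <= z.2) && (z.2 <= t z.1))).
    by apply: measurable_and; apply: measurable_fun_ler.
  by apply/funext => p; congr (Rintegral _ _ _); apply/seteqP; split=> s; rewrite /= in_itv.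
apply: measurable_funN; rewrite (_ : (fun p => _) =
    (fun p => (\int[lebesgue_measure]_(s in [set s | (t p <= s) && (s <= 0)]) h p s)%R)).
  apply: (restrict (fun z => (t z.1 <= z.2) && (z.2 <= 0))).
  by apply: measurable_and; apply: measurable_fun_ler.
by apply/funext => p; congr (Rintegral _ _ _); apply/seteqP; split=> s; rewrite /= in_itv.
Qed.

Variables (alpha beta : R).
Hypotheses (alpha0 : 0 < alpha) (beta0 : 0 < beta).

Let inv_quadratic s := (alpha * s ^+ 2 + beta)^-1.

Let continuous_inv_quadratic : continuous inv_quadratic.
Proof.
move=> s; apply: cvgV; first by rewrite gt_eqF// denom_gt0.
apply: cvgD; last exact: cvg_cst.
by apply: cvgM; [exact: cvg_cst|exact: exprn_continuous].
Qed.

Lemma inv_quadratic_integrable t1 t2 :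
  lebesgue_measure.-integrable `[t1, t2] (EFin \o inv_quadratic).
Proof.
apply: continuous_compact_integrable; first exact: segment_compact.
exact: continuous_subspaceT.
Qed.

(** The integral is an increment of an arctangent, at most [pi], divided by the square root of
    [alpha * beta]. *)
Lemma inv_quadratic_integral_le t1 t2 : t1 <= t2 ->
  (\int[lebesgue_measure]_(s in `[t1, t2]) inv_quadratic s)%R
    <= pi / Num.sqrt (alpha * beta).
Proof.
have ab0 : 0 < Num.sqrt (alpha * beta) by rewrite sqrtr_gt0 mulr_gt0.
have abE : Num.sqrt (alpha * beta) ^+ 2 = alpha * beta.
  by rewrite sqr_sqrtr// ltW// mulr_gt0.
move: ab0 abE; set r : R := Num.sqrt _ => ab0 abE.
rewrite le_eqVlt => /predU1P[->|t12].
  by rewrite set_itv1 Rintegral_set1 divr_ge0 ?pi_ge0// ltW.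
(* [k] is the square root of [alpha / beta], which makes [F] an antiderivative. *)
pose k : R := r / beta.
pose F (s : R) : R := atan (k * s) / r.
have dF (s : R) : is_derive s (1 : R) F (inv_quadratic s).
  rewrite /inv_quadratic.
  have -> : F = r^-1 *: (atan \o (k *: id)).
    by apply/funext => x; rewrite /F /= mulrC.
  have dk : is_derive s (1 : R) (k *: (id : R -> R)) (k *: 1) by exact: is_deriveZ.
  apply: is_derive_eq (is_deriveZ _ (is_derive1_comp (is_derive1_atan _) dk)) _.
  have -> : alpha = r ^+ 2 / beta by rewrite abE mulfK// gt_eqF.
  change (r^-1 * ((1 + (r / beta * s) ^+ 2)^-1 * (r / beta * 1)) =
    (r ^+ 2 / beta * s ^+ 2 + beta)^-1).
  by field; rewrite !gt_eqF//= ltr_wpDl ?sqr_ge0// mulr_gt0.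
rewrite /Rintegral (@continuous_FTC2 _ _ F)//=.
- rewrite /F -mulrBl ler_wpM2r ?invr_ge0 ?(ltW ab0)//.
  by have := atan_ltpi2 (k * t2); have := atan_gtNpi2 (k * t1); lra.
- exact: continuous_subspaceT.
- split.
  + by move=> x _; apply: ex_derive.
  + apply: cvg_at_right_filter; apply: differentiable_continuous.
    exact/derivable1_diffP/ex_derive.
  + apply: cvg_at_left_filter; apply: differentiable_continuous.
    exact/derivable1_diffP/ex_derive.
- by move=> x _; rewrite derive1E derive_val.
Qed.

(** The bound does not depend on [t]: decay like [s ^- 2] is what makes the estimate global in
    time. *)
Lemma oriented_integral_dominated K d c (a b : R -> R) t :
  0 <= K -> 0 <= d -> 0 <= c ->
  measurable_fun setT a -> measurable_fun setT b ->
  (forall s, dominated_pair K d (c / (alpha * s ^+ 2 + beta)) (a s) (b s)) ->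
  [/\ integral_0 (EFin \o a) t = (oriented_integral a t)%:E,
      integral_0 (EFin \o b) t = (oriented_integral b t)%:E &
      dominated_pair K d (c * (pi / Num.sqrt (alpha * beta)))
        (oriented_integral a t) (oriented_integral b t)].
Proof.
move=> K0 d0 c0 ma mb ab.
have seg t1 t2 : t1 <= t2 -> [/\
    lebesgue_measure.-integrable `[t1, t2] (EFin \o a),
    lebesgue_measure.-integrable `[t1, t2] (EFin \o b) &
    dominated_pair K d (c * (pi / Num.sqrt (alpha * beta)))
      (\int[lebesgue_measure]_(s in `[t1, t2]) a s)%R
      (\int[lebesgue_measure]_(s in `[t1, t2]) b s)%R].
  move=> t12; have iq := inv_quadratic_integrable t1 t2.
  have [||||ia ib iab] := @dominated_pair_integral R _ _ lebesgue_measure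
    `[t1, t2] K d (fun s => c * inv_quadratic s) a b _ _ _ _ (fun s _ => ab s).
  - exact: measurable_itv.
  - exact: measurable_funTS.
  - exact: measurable_funTS.
  - by rewrite (_ : EFin \o _ = (fun s => c%:E * (EFin \o inv_quadratic) s)%E)//;
      exact: integrableZl.
  split=> //; apply: dominated_pairW iab => //.
  by rewrite RintegralZl// ler_wpM2l// inv_quadratic_integral_le.
rewrite /integral_0 /oriented_integral; case: ifPn => [t0|].
  have [ia ib iab] := seg _ _ t0.
  by split=> //; rewrite /Rintegral fineK// integrable_fin_num.
rewrite -ltNge => /ltW t0; have [ia ib iab] := seg _ _ t0.
split; last exact: dominated_pairN.
  by rewrite /Rintegral EFinN fineK// integrable_fin_num.
by rewrite /Rintegral EFinN fineK// integrable_fin_num.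
Qed.

End time_integral.

(** * The Duhamel integral and mild solutions *)

Section duhamel.
Context {R : realType}.
Variables (alpha beta : R).
Hypotheses (alpha0 : 0 < alpha) (beta0 : 0 < beta).
Implicit Types (s t x y u v M D : R) (f g : R -> R -> R -> R).

Local Notation weight := (flow_weight alpha beta).

(** [x - t * v + s * v] is the position at time [s] of the free trajectory that passes through [x]
    at time [t]. *)
Definition duhamel_integral f t x v : R :=
  oriented_integral (fun s => collision f s (x - t * v + s * v) v) t.

Definition flow_bounded M f : Prop := forall t x v, `|f t x v| <= M * weight t x v.

Definition duhamel_constant : R :=
  collision_constant * (pi / Num.sqrt (alpha * beta)).

Lemma duhamel_constant_ge0 : 0 <= duhamel_constant.
Proof.
by rewrite mulr_ge0 ?collision_constant_ge0// divr_ge0 ?pi_ge0 ?sqrtr_ge0.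
Qed.

Lemma measurable_duhamel_integral f : jointly_measurable f ->
  jointly_measurable (duhamel_integral f).
Proof.
move=> mf; rewrite /jointly_measurable /duhamel_integral.
have m1 : measurable_fun setT (fun z : R * R * R * R => z.1.1.1).
  by do 2 apply: measurableT_comp => //.
have m2 : measurable_fun setT (fun z : R * R * R * R => z.1.1.2).
  by do 2 apply: measurableT_comp => //.
have m3 : measurable_fun setT (fun z : R * R * R * R => z.1.2).
  by apply: measurableT_comp.
have mz : measurable_fun setT (fun z : R * R * R * R =>
    (z.2, z.1.1.2 - z.1.1.1 * z.1.2 + z.2 * z.1.2, z.1.2)).
  apply: measurable_fun_pair => //; apply: measurable_fun_pair => //.
  by apply: measurable_funD; [apply: measurable_funB => //|]; exact: measurable_funM.
have mt : measurable_fun setT (fun p : R * R * R => p.1.1) by exact: measurableT_comp.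
have := @measurable_oriented_integral R _ _
  (fun (p : R * R * R) s => collision f s (p.1.2 - p.1.1 * p.2 + s * p.2) p.2)
  (fun p => p.1.1) (measurableT_comp (measurable_collision mf) mz) mt.
exact.
Qed.

Lemma flow_weight_transport s t x v :
  weight s (x - t * v + s * v) v = weight t x v.
Proof. by congr expR; ring. Qed.

(** The weight is constant along free trajectories and so comes out of the time integral. *)
Lemma duhamel_integral_dominated M D f g t x v : 0 <= M -> 0 <= D ->
  jointly_measurable f -> jointly_measurable g ->
  (forall s y u, dominated_pair M D (weight s y u) (f s y u) (g s y u)) ->
  [/\ integral_0 (fun s => C6 f s (x - t * v + s * v) v) t =
        (duhamel_integral f t x v)%:E,
      integral_0 (fun s => C6 g s (x - t * v + s * v) v) t =
        (duhamel_integral g t x v)%:E &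
      dominated_pair (6 * M ^+ 5) (30 * M ^+ 4 * D) (duhamel_constant * weight t x v)
        (duhamel_integral f t x v) (duhamel_integral g t x v)].
Proof.
move=> M0 D0 mf mg fg.
have C6fg s := C6_dominated alpha0 beta0 v M0 D0 mf mg (fg s (x - t * v + s * v)).
have meas h : jointly_measurable h ->
    measurable_fun setT (fun s => collision h s (x - t * v + s * v) v).
  move=> mh; have mz : measurable_fun setT (fun s : R => (s, x - t * v + s * v, v)).
    apply: measurable_fun_pair => //; apply: measurable_fun_pair => //.
    by apply: measurable_funD => //; exact: measurable_funM.
  exact: (measurableT_comp (measurable_collision mh) mz).
have K0 : 0 <= 6 * M ^+ 5 by rewrite mulr_ge0// exprn_ge0.
have d0 : 0 <= 30 * M ^+ 4 * D by rewrite !mulr_ge0// exprn_ge0.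
have c0 : 0 <= collision_constant * weight t x v.
  by rewrite mulr_ge0 ?collision_constant_ge0 ?expR_ge0.
have coll_dom s : dominated_pair (6 * M ^+ 5) (30 * M ^+ 4 * D)
    (collision_constant * weight t x v / (alpha * s ^+ 2 + beta))
    (collision f s (x - t * v + s * v) v) (collision g s (x - t * v + s * v) v).
  by have [_ _] := C6fg s; rewrite flow_weight_transport.
have [fE gE] := oriented_integral_dominated alpha0 beta0 t K0 d0 c0
  (meas f mf) (meas g mg) coll_dom.
have kE : collision_constant * weight t x v * (pi / Num.sqrt (alpha * beta)) =
    duhamel_constant * weight t x v by rewrite /duhamel_constant; ring.
have C6f : (fun s => C6 f s (x - t * v + s * v) v) =
    EFin \o (fun s => collision f s (x - t * v + s * v) v).
  by apply/funext => s; have [-> _ _] := C6fg s.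
have C6g : (fun s => C6 g s (x - t * v + s * v) v) =
    EFin \o (fun s => collision g s (x - t * v + s * v) v).
  by apply/funext => s; have [_ -> _] := C6fg s.
rewrite kE => dom; split; last exact: dom.
- exact: etrans (congr1 (fun h => integral_0 h t) C6f) fE.
- exact: etrans (congr1 (fun h => integral_0 h t) C6g) gE.
Qed.

Lemma norm_abP (g : R -> R -> R) r :
  (norm_ab alpha beta g <= r%:E)%E <-> (forall x v, `|g x v| <= r * weight 0 x v).
Proof.
have wE x v : expR (alpha * `|x| ^+ 2 + beta * `|v| ^+ 2) = (weight 0 x v)^-1.
  by rewrite -expRN opprK mul0r subr0 !real_normK ?num_real.
split=> [gr x v|gr].
  rewrite -ler_pdivrMr ?expR_gt0// -wE -lee_fin; apply: le_trans gr.
  by apply: ereal_sup_ubound; exists (x, v).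
apply: ge_ereal_sup => _ [[x v] _ <-] /=.
by rewrite lee_fin wE ler_pdivrMr ?expR_gt0.
Qed.

(** For each [t] the shift of [x] by [t * v] is a bijection that carries [weight 0] to
    [weight t]. *)
Lemma tnorm_along_flowP f r :
  (tnorm_ab alpha beta (along_flow f) <= r%:E)%E <-> flow_bounded r f.
Proof.
have along t x v : along_flow f t x v = f t (x + t * v) v.
  by rewrite /along_flow /transport mulNr opprK.
have wE t x v : weight t (x + t * v) v = weight 0 x v by congr expR; ring.
split=> [fr t x v|fr].
  have /norm_abP/(_ (x - t * v) v) : (norm_ab alpha beta (along_flow f t) <= r%:E)%E.
    by apply: le_trans fr; apply: ereal_sup_ubound; exists t.
  by rewrite along -(wE t) subrK.
apply: ge_ereal_sup => _ [t _ <-]; apply/norm_abP => x v.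
by rewrite along -(wE t).
Qed.

(** Under the bound the time integral is finite, so the identity in [\bar R] becomes a real one,
    read at the endpoint of the trajectory instead of its origin. *)
Lemma mild_solutionP M (f0 : R -> R -> R) f : 0 <= M -> flow_bounded M f ->
  mild_solution alpha beta f0 f <->
  jointly_measurable f /\
  (forall t x v, f t x v = f0 (x - t * v) v + duhamel_integral f t x v).
Proof.
move=> M0 fM.
have along t x v : along_flow f t x v = f t (x + t * v) v.
  by rewrite /along_flow /transport mulNr opprK.
have dom s y u : dominated_pair M 0 (weight s y u) (f s y u) (f s y u).
  by split; rewrite ?subrr ?normr0 ?mul0r.
have intE t x v : jointly_measurable f ->
    integral_0 (fun s => transport (- s) (C6 f) s (x - t * v) v) t =
    (duhamel_integral f t x v)%:E.
  move=> mf; have [fE _ _] := duhamel_integral_dominated t x v M0 (lexx 0) mf mf dom.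
  have trE : (fun s => transport (- s) (C6 f) s (x - t * v) v) =
      (fun s => C6 f s (x - t * v + s * v) v).
    by apply/funext => s; rewrite /transport mulNr opprK.
  exact: etrans (congr1 (fun h => integral_0 h t) trE) fE.
split=> [[mf _ fE]|[mf fE]].
  split=> // t x v; have := fE t (x - t * v) v.
  by rewrite intE// along subrK => -[].
split=> //.
  split.
    have mz : measurable_fun setT (fun z : R * R * R => (z.1.1, z.1.2 - - z.1.1 * z.2, z.2)).
      have m1 : measurable_fun setT (fun z : R * R * R => z.1.1) by exact: measurableT_comp.
      have m2 : measurable_fun setT (fun z : R * R * R => z.1.2) by exact: measurableT_comp.
      apply: measurable_fun_pair => //; apply: measurable_fun_pair => //.
      by apply: measurable_funB => //; apply: measurable_funM => //; exact: measurable_funN.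
    exact: (measurableT_comp mf mz).
  by apply: le_lt_trans (ltry M); exact/tnorm_along_flowP.
move=> t x v; rewrite along fE addrK EFinD; congr (_ + _)%E.
by have := intE t (x + t * v) v mf; rewrite (addrK (t * v) x) => ->.
Qed.

End duhamel.

Lemma ler_addgeo {R : realType} (a b c : R) : 0 <= c ->
  (forall n, a <= b + c / 2 ^+ n) -> a <= b.
Proof.
move=> c0 h; apply/ler_addgt0Pr => e e0.
(* [n] exceeds [c / e], hence so does [2 ^+ n]. *)
pose n := (Num.truncn (c / e)).+1; apply: le_trans (h n) _; rewrite lerD2l.
rewrite ler_pdivrMr ?exprn_gt0// mulrC -ler_pdivrMr//.
apply: le_trans (ltW (truncnS_gt _)) _.
by rewrite -natrX ler_nat ltnW// ltn_expl.
Qed.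

(** The sequence is squeezed between a nonincreasing [a] and a nondecreasing [b] whose gap tends to
    0; monotonicity gives both the limit and the rate. *)
Lemma geometric_limit {R : realType} (u : nat -> R) (c : R) : 0 <= c ->
  (forall n, `|u n.+1 - u n| <= c / 2 ^+ n) ->
  exists2 l, u @ \oo --> l & forall n, `|u n - l| <= 2 * c / 2 ^+ n.
Proof.
move=> c0 uc.
(* The sum of the tail [c / 2 ^+ k] over [k >= n]. *)
pose d n : R := 2 * c / 2 ^+ n.
have dS n : d n = d n.+1 + c / 2 ^+ n.
  rewrite /d exprS; field; exact: expf_neq0.
have d0 n : 0 <= d n by rewrite divr_ge0 ?mulr_ge0// exprn_ge0.
pose a n := u n + d n; pose b n := u n - d n.
have ani : nonincreasing_seq a.
  apply/nonincreasing_seqP => n; have := uc n; rewrite ler_norml => /andP[_ h].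
  by rewrite /a (dS n); lra.
have bnd : nondecreasing_seq b.
  apply/nondecreasing_seqP => n; have := uc n; rewrite ler_norml => /andP[h _].
  by rewrite /b (dS n); lra.
have alb : has_lbound (range a).
  exists (b 0%N) => _ [n _ <-]; apply: (@le_trans _ _ (b n)); first exact: bnd.
  by rewrite /a /b; have := d0 n; lra.
have acv := nonincreasing_is_cvgn ani alb.
have dcv : d @ \oo --> (0 : R).
  rewrite (_ : d = geometric (2 * c) 2^-1); last first.
    by apply/funext => n; rewrite /d /geometric/= exprVn.
  by apply: cvg_geometric; rewrite ger0_norm// invf_lt1// ltr1n.
have ucv : u @ \oo --> limn a.
  rewrite (_ : u = fun n => a n - d n); last by apply/funext => n; rewrite /a addrK.
  by rewrite -[limn a]subr0; apply: cvgB.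
have bcv : b @ \oo --> limn a by rewrite -[limn a]subr0; apply: cvgB.
exists (limn a) => // n; rewrite ler_distlC.
have := nonincreasing_cvgn_ge ani acv n.
have := nondecreasing_cvgn_le bnd (cvgP _ bcv) n; rewrite (cvg_lim _ bcv)//.
by rewrite /a /b /d => h1 h2; apply/andP; split; lra.
Qed.

(** * Picard iteration and stability *)

Section fixed_point.
Context {R : realType}.
Variables (alpha beta M : R).
Hypotheses (alpha0 : 0 < alpha) (beta0 : 0 < beta) (M0 : 0 <= M).
Hypothesis small : 30 * M ^+ 4 * duhamel_constant alpha beta <= 2^-1.
Implicit Types (s t x y u v D : R) (f g : R -> R -> R -> R).

Local Notation weight := (flow_weight alpha beta).
Local Notation bounded := (flow_bounded alpha beta).

Definition flow_diff f g : R -> R -> R -> R := fun t x v => f t x v - g t x v.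

Definition duhamel (f0 : R -> R -> R) f t x v : R := f0 (x - t * v) v + duhamel_integral f t x v.

Let weight_ge0 t x v : 0 <= weight t x v. Proof. exact: expR_ge0. Qed.

Lemma duhamel_integral_contract D f g : 0 <= D ->
  jointly_measurable f -> jointly_measurable g ->
  bounded M f -> bounded M g -> bounded D (flow_diff f g) ->
  bounded (D / 2) (flow_diff (duhamel_integral f) (duhamel_integral g)).
Proof.
move=> D0 mf mg fM gM fgD t x v.
have dom s y u : dominated_pair M D (weight s y u) (f s y u) (g s y u).
  by split; [exact: fM|exact: gM|exact: fgD].
have [_ _ [_ _ h]] := duhamel_integral_dominated alpha0 beta0 t x v M0 D0 mf mg dom.
apply: (le_trans h); rewrite mulrA ler_wpM2r// mulrAC mulrC ler_wpM2l//.
Qed.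

(** Comparing [f] with itself gives the factor [6 * M ^+ 5], that is [M] times [6 * M ^+ 4], and
    [6 <= 30] reduces to [small]. *)
Lemma duhamel_integral_bounded f : jointly_measurable f -> bounded M f ->
  bounded (M / 2) (duhamel_integral f).
Proof.
move=> mf fM t x v.
have dom s y u : dominated_pair M 0 (weight s y u) (f s y u) (f s y u).
  by split; rewrite ?subrr ?normr0 ?mul0r.
have [_ _ [h _ _]] := duhamel_integral_dominated alpha0 beta0 t x v M0 (lexx 0) mf mf dom.
apply: (le_trans h); rewrite mulrA ler_wpM2r//.
rewrite (_ : _ * duhamel_constant alpha beta =
  M * (6 * M ^+ 4 * duhamel_constant alpha beta)); last by ring.
rewrite ler_wpM2l//; apply: le_trans small.
by rewrite ler_wpM2r ?duhamel_constant_ge0// ler_wpM2r ?exprn_ge0// ler_nat.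
Qed.

(** By contraction a bound [D] on the difference improves to [delta + D / 2]; iterating from [2 * M]
    converges to [2 * delta]. *)
Lemma duhamel_stability delta (f0 g0 : R -> R -> R) f g : 0 <= delta ->
  jointly_measurable f -> jointly_measurable g -> bounded M f -> bounded M g ->
  (forall t x v, f t x v = duhamel f0 f t x v) ->
  (forall t x v, g t x v = duhamel g0 g t x v) ->
  (forall x v, `|f0 x v - g0 x v| <= delta * weight 0 x v) ->
  bounded (2 * delta) (flow_diff f g).
Proof.
move=> delta0 mf mg fM gM fE gE fg0.
have iter n : bounded (2 * delta + 2 * M / 2 ^+ n) (flow_diff f g).
  elim: n => [|n ih] t x v.
    have hf := fM t x v; have hg := gM t x v.
    apply: le_trans (ler_normB _ _) _; apply: (le_trans (lerD hf hg)).
    by rewrite -mulrDl ler_wpM2r// expr0 divr1; lra.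
  have D0 : 0 <= 2 * delta + 2 * M / 2 ^+ n.
    by rewrite addr_ge0 ?mulr_ge0 ?invr_ge0 ?exprn_ge0.
  have h := duhamel_integral_contract D0 mf mg fM gM ih t x v.
  have h0 : `|f0 (x - t * v) v - g0 (x - t * v) v| <= delta * weight t x v.
    by apply: le_trans (fg0 _ _) _; rewrite -(flow_weight_transport _ _ 0 t) mul0r addr0.
  rewrite /flow_diff fE gE /duhamel opprD addrACA.
  apply: le_trans (ler_normD _ _) _; apply: (le_trans (lerD h0 h)).
  rewrite -mulrDl ler_wpM2r// le_eqVlt; apply/orP; left; apply/eqP.
  by rewrite exprS; field; rewrite expf_neq0.
move=> t x v; apply: (@ler_addgeo _ _ _ (2 * M * weight t x v)).
  by rewrite !mulr_ge0.
by move=> n; apply: le_trans (iter n t x v) _; rewrite mulrDl [2 * M / _ * _]mulrAC.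
Qed.

Lemma measurable_duhamel (f0 : R -> R -> R) f : measurable_fun setT (fun p : R * R => f0 p.1 p.2) ->
  jointly_measurable f -> jointly_measurable (duhamel f0 f).
Proof.
move=> mf0 mf; apply: measurable_funD; last exact: measurable_duhamel_integral.
have mz : measurable_fun setT (fun p : R * R * R => (p.1.2 - p.1.1 * p.2, p.2)).
  have m1 : measurable_fun setT (fun z : R * R * R => z.1.1) by exact: measurableT_comp.
  have m2 : measurable_fun setT (fun z : R * R * R => z.1.2) by exact: measurableT_comp.
  apply: measurable_fun_pair => //.
  by apply: measurable_funB => //; exact: measurable_funM.
exact: (measurableT_comp mf0 mz).
Qed.

Lemma duhamel_bounded (f0 : R -> R -> R) f : (forall x v, `|f0 x v| <= M / 2 * weight 0 x v) ->
  jointly_measurable f -> bounded M f -> bounded M (duhamel f0 f).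
Proof.
move=> f0M mf fM t x v.
have h0 : `|f0 (x - t * v) v| <= M / 2 * weight t x v.
  by apply: le_trans (f0M _ _) _; rewrite -(flow_weight_transport _ _ 0 t) mul0r addr0.
apply: le_trans (ler_normD _ _) _.
apply: (le_trans (lerD h0 (duhamel_integral_bounded mf fM t x v))).
by rewrite -mulrDl ler_wpM2r//; lra.
Qed.

(** The iterates from 0 stay in the ball and converge pointwise at a geometric rate relative to the
    weight; measurability and the bound pass to the limit. *)
Lemma duhamel_fixed_point (f0 : R -> R -> R) : measurable_fun setT (fun p : R * R => f0 p.1 p.2) ->
  (forall x v, `|f0 x v| <= M / 2 * weight 0 x v) ->
  exists f, [/\ jointly_measurable f, bounded M f &
                forall t x v, f t x v = duhamel f0 f t x v].
Proof.
move=> mf0 f0M.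
have [u u0 uS] : exists2 u : nat -> R -> R -> R -> R,
    u 0%N = (fun _ _ _ => 0) & forall n, u n.+1 = duhamel f0 (u n).
  by exists (fun n => iter n (duhamel f0) (fun _ _ _ => 0)).
have mu n : jointly_measurable (u n).
  elim: n => [|n ih]; [by rewrite u0; exact: measurable_cst|].
  by rewrite uS; exact: measurable_duhamel.
have uM n : bounded M (u n).
  elim: n => [|n ih]; last by rewrite uS; exact: duhamel_bounded.
  by move=> t x v; rewrite u0 normr0 mulr_ge0.
have du n : bounded (M / 2 ^+ n) (flow_diff (u n.+1) (u n)).
  elim: n => [|n ih] t x v.
    by rewrite /flow_diff u0 subr0 expr0 divr1; exact: uM.
  have Mn0 : 0 <= M / 2 ^+ n by rewrite divr_ge0// exprn_ge0.
  have h := duhamel_integral_contract Mn0 (mu n.+1) (mu n) (uM n.+1) (uM n) ih t x v.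
  rewrite exprSr invfM mulrA; apply: le_trans h; rewrite /flow_diff [in u n.+2]uS.
  by rewrite [X in _ - X t x v]uS /duhamel opprD addrACA subrr add0r.
have ulim t x v : exists2 l, u n t x v @[n --> \oo] --> l &
    forall n, `|u n t x v - l| <= 2 * (M * weight t x v) / 2 ^+ n.
  apply: geometric_limit; first by rewrite mulr_ge0.
  by move=> n; apply: le_trans (du n t x v) _; rewrite mulrAC.
have [f uf] : exists f, forall t x v, u n t x v @[n --> \oo] --> f t x v.
  exists (fun t x v => limn (fun n => u n t x v)) => t x v.
  by have [l ul _] := ulim t x v; rewrite (cvg_lim _ ul).
have uf_le n : bounded (2 * M / 2 ^+ n) (flow_diff (u n) f).
  move=> t x v; have [l ul h] := ulim t x v.
  have -> : 2 * M / 2 ^+ n * weight t x v = 2 * (M * weight t x v) / 2 ^+ n by ring.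
  rewrite /flow_diff (_ : f t x v = l); first exact: h.
  by rewrite -(cvg_lim _ (uf t x v))// (cvg_lim _ ul).
have mf : jointly_measurable f.
  apply: (measurable_fun_cvg (h := fun n (p : R * R * R) => u n p.1.1 p.1.2 p.2)).
    by move=> n; exact: mu.
  by move=> p _; exact: uf.
have fM : bounded M f.
  move=> t x v; apply: (@ler_addgeo _ _ _ (2 * M * weight t x v)).
    by rewrite !mulr_ge0.
  move=> n; have h := uf_le n t x v; have h' := uM n t x v.
  rewrite (_ : f t x v = u n t x v - flow_diff (u n) f t x v); last first.
    by rewrite /flow_diff; ring.
  apply: le_trans (ler_normB _ _) _; apply: (le_trans (lerD h' h)).
  by rewrite [2 * M / _ * _]mulrAC.
exists f; split=> // t x v; apply/eqP; rewrite -subr_eq0 -normr_le0.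
apply: (@ler_addgeo _ _ _ (2 * M * weight t x v)); first by rewrite !mulr_ge0.
move=> n; rewrite add0r.
have D0 : 0 <= 2 * M / 2 ^+ n by rewrite divr_ge0 ?mulr_ge0// exprn_ge0.
have h := duhamel_integral_contract D0 (mu n) mf (uM n) fM (uf_le n) t x v.
have h' := uf_le n.+1 t x v.
(* The defect of [f] is compared with the exact relation between [u n] and [u n.+1]; both resulting
   terms are of order [M / 2 ^+ n]. *)
have -> : f t x v - duhamel f0 f t x v =
    flow_diff (duhamel_integral (u n)) (duhamel_integral f) t x v
    - flow_diff (u n.+1) f t x v.
  rewrite /flow_diff uS /duhamel.
  move: (duhamel_integral (u n) t x v) (duhamel_integral f t x v) => a b.
  by ring.
apply: le_trans (ler_normB _ _) _; apply: (le_trans (lerD h h')).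
rewrite -mulrDl [leRHS]mulrAC ler_wpM2r// exprS.
rewrite le_eqVlt; apply/orP; left; apply/eqP; field; exact: expf_neq0.
Qed.

End fixed_point.

(** * The smallness condition and the well-posedness theorem *)

Lemma small_data {R : realType} (alpha beta Re : R) :
  0 < alpha -> 0 < beta -> 0 < Re ->
  Re <= alpha `^ (1 / 8) /
    (2 `^ (7 / 2) * C1_beta (1 + collision_constant * pi) beta `^ (1 / 4)) ->
  30 * (2 * Re) ^+ 4 * duhamel_constant alpha beta <= 2^-1.
Proof.
move=> alpha0 beta0 Re0; set kappa : R := collision_constant * pi.
have kappa0 : 0 <= kappa by rewrite mulr_ge0 ?collision_constant_ge0 ?pi_ge0.
set C := C1_beta _ _ => ReC.
have half_le : 2^-1 <= 2 `^ (- (1 / 2)) :> R.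
  by rewrite -[leLHS]powR_inv1// ler_powR// ?ler1n//; lra.
have C0 : 0 < C.
  rewrite /C /C1_beta !mulr_gt0 ?powR_gt0//; last by rewrite addr_gt0 ?invr_gt0.
  by rewrite ltr_pwDl.
have a0 : 0 < Num.sqrt alpha by rewrite sqrtr_gt0.
have b0 : 0 < Num.sqrt beta by rewrite sqrtr_gt0.
have bE : Num.sqrt beta ^+ 2 = beta by rewrite sqr_sqrtr// ltW.
have powR4 (x y : R) : (x `^ y) ^+ 4 = x `^ (y * 4).
  by rewrite powRrM powR_mulrn// powR_ge0.
(* The fourth power of the assumption on [Re], with [128 * 128 = 2 ^ 14] coming from
   [2 ^ (7 / 2)]. *)
have Re4 : Re ^+ 4 * ((128 * 128) * C) <= Num.sqrt alpha.
  have d0 : 0 < (128 * 128) * C by rewrite mulr_gt0// mulr_gt0.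
  rewrite -ler_pdivlMr//.
  rewrite (_ : _ / _ = (alpha `^ (1 / 8) / (2 `^ (7 / 2) * C `^ (1 / 4))) ^+ 4).
    by rewrite lerXn2r ?nnegrE ?(ltW Re0)// (le_trans (ltW Re0)).
  rewrite expr_div_n exprMn !powR4.
  rewrite (_ : 1 / 8 * 4 = 2^-1); last by field.
  rewrite (_ : 7 / 2 * 4 = 14%:R); last by field.
  rewrite (_ : 1 / 4 * 4 = 1); last by field.
  rewrite powR12_sqrt ?(ltW alpha0)// powRr1 ?(ltW C0)// powR_mulrn//.
  by congr (_ / (_ * _)); rewrite (exprD 2 7 7) -natrX.
have Cb : kappa / 2 <= C * Num.sqrt beta.
  (* The product is [b^-1 + b] with [b] the square root of [beta], and one of the two terms is at
     least 1. *)
  have bb : 1 <= (beta^-1 + 1) * Num.sqrt beta.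
    rewrite -[X in X^-1]bE (_ : _ * _ = (Num.sqrt beta)^-1 + Num.sqrt beta); last first.
      by field; rewrite gt_eqF.
    have [b1|b1] := leP 1 (Num.sqrt beta).
      by rewrite ler_wpDl ?invr_ge0 ?(ltW b0).
    by rewrite ler_wpDr ?(ltW b0)// invf_ge1// ltW.
  rewrite /C /C1_beta -mulrA; apply: (@le_trans _ _ (2^-1 * (1 + kappa) * 1)); first lra.
  apply: ler_pM => //; first by rewrite mulr_ge0// addr_ge0.
  by rewrite ler_wpM2r// addr_ge0.
have key : 64 * 128 * Re ^+ 4 * kappa <= Num.sqrt alpha * Num.sqrt beta.
  have := ler_wpM2r (ltW b0) Re4; apply: le_trans.
  rewrite (_ : 64 * 128 * _ * kappa = Re ^+ 4 * (128 * 128) * (kappa / 2)); last by field.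
  rewrite (_ : Re ^+ 4 * ((128 * 128) * C) * _ =
    Re ^+ 4 * (128 * 128) * (C * Num.sqrt beta)); last by ring.
  by rewrite ler_wpM2l// mulr_ge0// exprn_ge0// ltW.
have -> : duhamel_constant alpha beta = kappa / (Num.sqrt alpha * Num.sqrt beta).
  by rewrite /duhamel_constant sqrtrM ?(ltW alpha0)// mulrA.
rewrite mulrA ler_pdivrMr ?mulr_gt0// exprMn.
have Rk : 0 <= Re ^+ 4 * kappa by rewrite mulr_ge0// exprn_ge0// ltW.
move: key; rewrite (_ : 64 * 128 * _ * _ = 64 * 128 * (Re ^+ 4 * kappa)); last by ring.
(* Here [480 = 30 * 2 ^ 4], and twice this is well below [64 * 128]. *)
rewrite (_ : 30 * _ * _ = 480 * (Re ^+ 4 * kappa)); last by ring.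
lra.
Qed.

Lemma norm_ab_ge0 {R : realType} (alpha beta : R) g : (0 <= norm_ab alpha beta g)%E.
Proof.
apply: le_trans (ereal_sup_ubound (ex_intro2 _ _ (0 : R, 0 : R) I erefl)).
by rewrite lee_fin mulr_ge0// expR_ge0.
Qed.

Unset Implicit Arguments.

Theorem theorem2p3 (R : realType) :
  exists2 C1 : R, 0 < C1 &
  forall alpha beta Re : R, 0 < alpha -> 0 < beta -> 0 < Re ->
  Re <= alpha `^ (1 / 8) / (2 `^ (7 / 2) * C1_beta C1 beta `^ (1 / 4)) ->
  (forall f0 : R -> R -> R,
     M_space alpha beta f0 -> (norm_ab alpha beta f0 <= Re%:E)%E ->
     exists! f : R -> R -> R -> R,
       mild_solution alpha beta f0 f /\
       (tnorm_ab alpha beta (along_flow f) <= (2 * Re)%:E)%E) /\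
  (forall (f0 g0 : R -> R -> R) (f g : R -> R -> R -> R),
     M_space alpha beta f0 -> M_space alpha beta g0 ->
     (norm_ab alpha beta f0 <= Re%:E)%E ->
     (norm_ab alpha beta g0 <= Re%:E)%E ->
     mild_solution alpha beta f0 f -> mild_solution alpha beta g0 g ->
     (tnorm_ab alpha beta (along_flow f) <= (2 * Re)%:E)%E ->
     (tnorm_ab alpha beta (along_flow g) <= (2 * Re)%:E)%E ->
     (tnorm_ab alpha beta
        (fun t x v => along_flow f t x v - along_flow g t x v)%R
      <= 2%:E * norm_ab alpha beta (fun x v => f0 x v - g0 x v)%R)%E).
Proof.
(* The summand 1 makes the constant positive from [collision_constant_ge0] alone. *)
exists (1 + collision_constant * pi).
  by rewrite ltr_pwDl// mulr_ge0 ?collision_constant_ge0 ?pi_ge0.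
move=> alpha beta Re alpha0 beta0 Re0 Re_small.
have small := small_data alpha0 beta0 Re0 Re_small.
have M0 : 0 <= 2 * Re by rewrite mulr_ge0// ltW.
(* Used with [delta = 0] for uniqueness, and with the norm of [f0 - g0] for part (b). *)
have stab (delta : R) (f0 g0 : R -> R -> R) f g : 0 <= delta ->
    mild_solution alpha beta f0 f -> mild_solution alpha beta g0 g ->
    flow_bounded alpha beta (2 * Re) f -> flow_bounded alpha beta (2 * Re) g ->
    (norm_ab alpha beta (fun x v => f0 x v - g0 x v)%R <= delta%:E)%E ->
    flow_bounded alpha beta (2 * delta) (flow_diff f g).
  move=> delta0 fS gS fM gM /norm_abP fg0.
  have [mf fE] := (mild_solutionP alpha0 beta0 f0 M0 fM).1 fS.
  have [mg gE] := (mild_solutionP alpha0 beta0 g0 M0 gM).1 gS.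
  exact: (duhamel_stability alpha0 beta0 M0 small delta0 mf mg fM gM fE gE fg0).
split=> [f0 [mf0 _] /norm_abP f0Re|f0 g0 f g _ _ f0Re g0Re fS gS].
  have [x v|f [mf fM fE]] := duhamel_fixed_point alpha0 beta0 M0 small mf0.
    by rewrite (_ : 2 * Re / 2 = Re)//; field.
  have fS : mild_solution alpha beta f0 f by apply/(mild_solutionP alpha0 beta0 _ M0 fM).
  exists f; split=> [|g [gS /tnorm_along_flowP gM]].
    by split=> //; exact/tnorm_along_flowP.
  have f00 : (norm_ab alpha beta (fun x v => f0 x v - f0 x v)%R <= 0%:E)%E.
    by apply/norm_abP => x v; rewrite subrr normr0 mul0r.
  have fg := stab 0 f0 f0 f g (lexx 0) fS gS fM gM f00.
  apply/funext => t; apply/funext => x; apply/funext => v.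
  by have := fg t x v; rewrite mulr0 mul0r normr_le0 subr_eq0 => /eqP.
move=> /tnorm_along_flowP fM /tnorm_along_flowP gM.
(* This makes the norm of the difference finite, hence a real number [delta]. *)
have N2 : (norm_ab alpha beta (fun x v => f0 x v - g0 x v)%R <= (2 * Re)%:E)%E.
  apply/norm_abP => x v; apply: le_trans (ler_normB _ _) _.
  move/norm_abP in f0Re; move/norm_abP in g0Re.
  by apply: (le_trans (lerD (f0Re x v) (g0Re x v))); rewrite -mulrDl mulr_natl mulr2n.
have N0 : (0 <= norm_ab alpha beta (fun x v => (f0 x v - g0 x v)%R))%E.
  exact: norm_ab_ge0.
have [delta deltaE] : exists delta,
    norm_ab alpha beta (fun x v => (f0 x v - g0 x v)%R) = delta%:E.
  exists (fine (norm_ab alpha beta (fun x v => (f0 x v - g0 x v)%R))).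
  by rewrite fineK// ge0_fin_numE// (le_lt_trans N2)// ltry.
have delta0 : 0 <= delta by rewrite -lee_fin -deltaE.
have fg := stab delta f0 g0 f g delta0 fS gS fM gM.
rewrite deltaE -EFinM; apply/(tnorm_along_flowP _ _ (flow_diff f g)).
by apply: fg; rewrite deltaE.
Qed.
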